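(* Let $d\ge2$, let $\theta\in\mathbb{R}^d$ be a unit vector (in Euclidean norm), let $t\ge0$, and let $f(x)=1\{\theta^{\mathsf T}x>t\}$ for $x\in\mathbb{R}^d$, with $x\sim\mathcal{N}(0,I_d)$. Then $$\nu(f)\le\frac{\|\theta\|_1}{\Phi(t)\Phi(-t)\sqrt{2\pi}}\Bigl(\sqrt{2}+2\sqrt{\log(\|\theta\|_1^{-1}d)}\Bigr),$$ and the right hand side is $O\bigl(\sqrt{d\log(d)}\bigr)$ as $d\to\infty$ for fixed $t$.
   Context: $\Phi$ is the standard Gaussian cumulative distribution function and $\|\theta\|_1=\sum_{j=1}^d|\theta_j|$. Mean dimension: let $x=(x_1,\dots,x_d)$ have independent components (here $x\sim\mathcal{N}(0,I_d)$) and let $f$ be measurable with $E(f(x)^2)<\infty$. For $u\subseteq\{1,\dots,d\}$ the ANOVA components are defined recursively by $f_u(x)=E(f(x)\mid x_u)-\sum_{v\subsetneq u}f_v(x)$, where $x_u=(x_j)_{j\in u}$, so $f=\sum_u f_u$, the $f_u$ are mutually orthogonal in $L^2$, and $f_\emptyset=E(f(x))$. Put $\sigma_u^2=E(f_u(x)^2)$ for $u\neq\emptyset$ and $\sigma^2_\emptyset=0$, so $\sigma^2=\mathrm{Var}(f(x))=\sum_u\sigma_u^2$. When $\sigma^2>0$, the mean dimension of $f$ is $\nu(f)=\sum_u|u|\sigma_u^2\big/\sum_u\sigma_u^2$. *)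

(* Defs.v *)
From HB Require Import structures.
From mathcomp Require Import all_boot all_order all_algebra.
From mathcomp Require Import all_classical all_reals all_analysis.
Import Order.TTheory GRing.Theory Num.Theory.
Import numFieldNormedType.Exports.

Set Implicit Arguments.
Unset Strict Implicit.
Unset Printing Implicit Defensive.

Local Open Scope classical_set_scope.
Local Open Scope ring_scope.

Section std_gaussian.
Context {R : realType}.

Definition cons_pair (d : nat) (p : measurableTypeR R * d.-tuple R) :
  d.+1.-tuple R := [the d.+1.-tuple R of p.1 :: p.2].

Lemma measurable_cons_pair (d : nat) : measurable_fun setT (@cons_pair d).
Proof. exact: measurable_cons. Qed.

HB.instance Definition _ (d : nat) :=
  isMeasurableFun.Build _ _ _ _ (@cons_pair d) (@measurable_cons_pair d).

(* N(0, I_d) on d.-tuple R with its product sigma-algebra: the image of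
   N(0, 1) \x N(0, I_(d-1)) under (x_1, x') |-> x_1 :: x'. *)
Fixpoint std_gaussian (d : nat) : probability (d.-tuple R) R :=
  if d is d'.+1 then
    distribution (normal_prob 0 1 \x std_gaussian d')%E (@cons_pair d')
  else \d_[tuple].

Lemma std_gaussian_box (d : nat) (A : 'I_d -> set R) :
  (forall i, measurable (A i)) ->
  std_gaussian d [set x | forall i, A i (tnth x i)] =
  (\prod_(i < d) normal_prob 0 1 (A i))%E.
Proof.
elim: d A => [|d IHd] A mA.
  rewrite big_ord0 /= diracE (_ : _ \in _ = true) //.
  by apply/mem_set => -[].
rewrite big_ord_recl -(IHd (fun i => A (lift ord0 i))) //=.
have mB : measurable [set x | forall i, A (lift ord0 i) (tnth x i)].
  rewrite (_ : [set x | _] =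
      \bigcap_(i in [set: 'I_d]) ((fun x => tnth x i) @^-1` A (lift ord0 i))).
    apply: fin_bigcap_measurable => // i _.
    by rewrite -[X in measurable X]setTI; exact: measurable_tnth.
  by apply/seteqP; split => x /= Ax i; [move=> _; exact: Ax|exact: Ax].
rewrite /distribution /pushforward.
have -> : @cons_pair d @^-1` [set x | forall i, A i (tnth x i)] =
    A ord0 `*` [set x | forall i, A (lift ord0 i) (tnth x i)].
  apply/seteqP; split => -[y x] /=.
    move=> Ax; split => [|i]; first exact: (Ax ord0).
    by have := Ax (lift ord0 i); rewrite tnthS.
  move=> [/= Ay Ax] i; have [j|] := unliftP ord0 i; move=> ->; last exact: Ay.
  by rewrite tnthS.
by apply: product_measure1E; [exact: mA|exact: mB].
Qed.

Definition Phi (t : R) : R := fine (normal_prob 0 1 `]-oo, t]).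

End std_gaussian.

Section mean_dimension.
Context {R : realType} {d : nat}.
Implicit Types (P : probability (d.-tuple R) R) (f g : d.-tuple R -> R).
Implicit Types u v : {set 'I_d}.

Definition sigma_coord u : set (set (d.-tuple R)) :=
  <<s \big[setU/set0]_(j in u)
        preimage_set_system setT (fun x => tnth x j) measurable >>.

Definition is_cond_exp P (G : set (set (d.-tuple R))) f g : Prop :=
  [/\ forall B : set R, measurable B -> G (g @^-1` B),
      P.-integrable setT (EFin \o g) &
      forall A, G A ->
        (\int[P]_(x in A) (g x)%:E = \int[P]_(x in A) (f x)%:E)%E].

(* A chosen version of E(f(x) | x_u); for integrable f one exists, and any two
   agree P-almost everywhere, so that the choice does not affect [sigma2]. *)
Definition cond_exp P f u : d.-tuple R -> R :=
  xget (cst 0) [set g | is_cond_exp P (sigma_coord u) f g].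

(* The recursion on u is run with fuel; [anovaE] is the defining equation. *)
Fixpoint anova_rec (n : nat) P f u (x : d.-tuple R) : R :=
  if n is n'.+1 then
    cond_exp P f u x - \sum_(v : {set 'I_d} | v \proper u) anova_rec n' P f v x
  else 0.

Definition anova P f u : d.-tuple R -> R := anova_rec #|u|.+1 P f u.

Lemma anova_rec_fuel (n m : nat) P f u x :
  (#|u| < n)%N -> (#|u| < m)%N -> anova_rec n P f u x = anova_rec m P f u x.
Proof.
elim: n m u => [|n IHn] [|m] u //; rewrite !ltnS => un um /=.
congr (_ - _); apply: eq_bigr => v /proper_card vu.
by apply: IHn; exact: leq_trans vu _.
Qed.

Lemma anovaE P f u x :
  anova P f u x =
  cond_exp P f u x - \sum_(v : {set 'I_d} | v \proper u) anova P f v x.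
Proof.
rewrite {1}/anova /=; congr (_ - _); apply: eq_bigr => v /proper_card vu.
exact: anova_rec_fuel.
Qed.

Definition sigma2 P f u : R :=
  if u == finset.set0 then 0 else fine 'E_P[fun x => anova P f u x ^+ 2].

Definition mean_dim P f : R :=
  (\sum_(u : {set 'I_d}) #|u|%:R * sigma2 P f u) /
  (\sum_(u : {set 'I_d}) sigma2 P f u).

End mean_dimension.

Section ridge.
Context {R : realType} {d : nat}.
Implicit Types theta : 'rV[R]_d.

Definition norm1 theta : R := \sum_(j < d) `|theta 0 j|.

Definition norm2 theta : R := Num.sqrt (\sum_(j < d) theta 0 j ^+ 2).

Definition ridge_step theta (t : R) : d.-tuple R -> R :=
  \1_[set x | t < \sum_(j < d) theta 0 j * tnth x j].

Definition mean_dim_bound theta (t : R) : R :=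
  norm1 theta / (Phi t * Phi (- t) * Num.sqrt (2 * pi)) *
  (Num.sqrt 2 + 2 * Num.sqrt (ln ((norm1 theta)^-1 * d%:R))).

End ridge.

(* Main.v *)
(* Let A_u f ([average u f]) be the average of f over the coordinates outside u,
   replaced by those of an independent copy z of x. Swapping the coordinates outside u of
   x and z preserves their joint law, so A_u is self-adjoint; moreover
   A_u A_v = A_(u :&: v) and A_u f is a version of E(f | x_u). With
   M(u) = <f, A_u f> this gives <A_u f, A_v f> = M(u :&: v), whence the ANOVA
   components are orthogonal and the variances of those indexed by subsets of u
   add up to M(u). Therefore the mean dimension of f is
     (\sum_j (M(all) - M(all but j))) / (M(all) - M(none)).
   For f = 1{theta.x > t} the denominator is Phi(t) Phi(-t), and the j-th term
   of the numerator is the probability that theta.x > t while resampling x_j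
   brings theta.x down to t or below. Given x_j and its copy z_j, the remaining
   part of theta.x, which is N(0, 1 - theta_j^2), has to fall into an interval
   of length (theta_j (x_j - z_j))_+, so that the term is at most
   |theta_j| / (pi sqrt (1 - theta_j^2)). This is at most |theta_j| / sqrt pi
   if 1 - theta_j^2 >= 1 / pi; otherwise |theta_j| is so large that the trivial
   bound Phi(t) Phi(-t) <= 1/4 is below |theta_j| / sqrt pi. Summing over j
   yields the claim even without the logarithmic term. *)
Require Import Defs.
From mathcomp Require Import all_boot all_order all_algebra.
From mathcomp Require Import all_classical all_reals all_analysis.
From mathcomp Require Import measurable_realfun ring lra.
Import Order.TTheory GRing.Theory Num.Theory.
Import numFieldNormedType.Exports.

Set Implicit Arguments.
Unset Strict Implicit.
Unset Printing Implicit Defensive.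

Local Open Scope classical_set_scope.
Local Open Scope ring_scope.

(** * Integrals against normal laws *)

Section iterated_integrals.
Local Open Scope ereal_scope.
Context d1 d2 (T1 : measurableType d1) (T2 : measurableType d2) (R : realType).
Context (m1 : {sigma_finite_measure set T1 -> \bar R}).
Context (m2 : {sigma_finite_measure set T2 -> \bar R}).
Variable f : T1 -> T2 -> \bar R.
Hypotheses (mf : measurable_fun setT (fun p : T1 * T2 => f p.1 p.2)).
Hypothesis f0 : forall x y, 0 <= f x y.

(** Tonelli for curried integrands, the shape in which nested integrals occur below. *)
Lemma measurable_fun_ge0_integral :
  measurable_fun setT (fun x => \int[m2]_y f x y).
Proof.
exact: (@measurable_fun_fubini_tonelli_F _ _ _ _ _ m2
  (fun p : T1 * T2 => f p.1 p.2)).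
Qed.

Lemma ge0_integral_exchange :
  \int[m1]_x \int[m2]_y f x y = \int[m2]_y \int[m1]_x f x y.
Proof.
exact: (@fubini_tonelli _ _ _ _ _ m1 m2 (fun p : T1 * T2 => f p.1 p.2)) => -[].
Qed.

End iterated_integrals.

Section normal_integral.
Local Open Scope ereal_scope.
Context {R : realType}.
Local Notation mu := (@lebesgue_measure R).
Implicit Types (m s a b : R) (F : R -> \bar R).

(** The Radon-Nikodym derivative of the normal law and [normal_pdf] have the same integral over
    every measurable set, so they agree almost everywhere. *)
Lemma ge0_integral_normal_prob m s F :
  measurable_fun setT F -> (forall x, 0 <= F x) ->
  \int[normal_prob m s]_x F x = \int[mu]_x (F x * (normal_pdf m s x)%:E).
Proof.
move=> mF F0; have dom := @normal_prob_dominates R m s.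
rewrite -(Radon_Nikodym_SigmaFinite.change_of_variables dom)//.
have mpdf : measurable_fun setT (fun x => (normal_pdf m s x)%:E).
  by apply/measurable_EFinP; exact: measurable_normal_pdf.
have iRN := Radon_Nikodym_SigmaFinite.f_integrable dom.
have mRN := measurable_int _ iRN.
have RN0 := Radon_Nikodym_SigmaFinite.f_ge0 dom.
apply: ge0_ae_eq_integral => //.
- exact: emeasurable_funM.
- exact: emeasurable_funM.
- by move=> x _; rewrite mule_ge0.
- by move=> x _; rewrite mule_ge0// lee_fin normal_pdf_ge0.
apply: ae_eqe_mul2l; apply: integral_ae_eq => //= E _ mE.
by rewrite -Radon_Nikodym_SigmaFinite.f_integral.
Qed.

(** Uniqueness of Lebesgue measure: [s] times its image under [x |-> m + s * x] gives every interval
    []a, b]] its length. *)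
Lemma lebesgue_measure_affine m s (A : set R) : (0 < s)%R -> measurable A ->
  mu ((fun x => m + s * x)%R @^-1` A) = s^-1%:E * mu A.
Proof.
move=> s0 mA; pose h : measurableTypeR R -> measurableTypeR R :=
  fun x => (m + s * x)%R.
have mh : measurable_fun setT h.
  by apply: measurable_funD => //; exact: measurable_funM.
have s0' : (0 <= s)%R by rewrite ltW.
pose nu := mscale (NngNum s0') (pushforward mu h).
have -> : mu A = nu mh A.
  apply: lebesgue_measure_unique => //= _ [[a b]] _ <-.
  rewrite /nu /mscale /= /pushforward.
  have -> : h @^-1` `]a, b] = [set` `]((a - m) / s)%R, ((b - m) / s)%R]].
    apply/seteqP; split => x /=; rewrite !in_itv/= /h => /andP[ax xb];
      apply/andP; split.
    - by rewrite ltr_pdivrMr// ltrBlDr mulrC addrC.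
    - by rewrite ler_pdivlMr// lerBrDr mulrC addrC.
    - by rewrite addrC -ltrBlDr mulrC -ltr_pdivrMr.
    - by rewrite addrC -lerBrDr mulrC -ler_pdivlMr.
  rewrite !lebesgue_measure_itv/= !lte_fin.
  rewrite ltr_pM2r ?invr_gt0// ltrD2r; case: ifPn => ab; last by rewrite mule0.
  by rewrite -!EFinB -EFinM; congr EFin; field; rewrite gt_eqF.
by rewrite /nu /mscale /= /pushforward muleA -EFinM mulVf ?gt_eqF// mul1e.
Qed.

Lemma ge0_integral_lebesgue_affine m s F : (0 < s)%R ->
  measurable_fun setT F -> (forall x, 0 <= F x) ->
  \int[mu]_x F (m + s * x)%R = s^-1%:E * \int[mu]_x F x.
Proof.
move=> s0 mF F0.
pose h : measurableTypeR R -> measurableTypeR R := fun x => (m + s * x)%R.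
have mh : measurable_fun setT h.
  by apply: measurable_funD => //; exact: measurable_funM.
have s0' : (0 <= s^-1)%R by rewrite invr_ge0 ltW.
transitivity (\int[pushforward mu h]_x F x).
  by rewrite ge0_integral_pushforward.
transitivity (\int[mscale (NngNum s0') mu]_x F x); last first.
  by rewrite ge0_integral_mscale.
by apply: eq_measure_integral => A mA _; exact: lebesgue_measure_affine.
Qed.

Lemma normal_peakE s : (0 < s)%R -> normal_peak s = (s^-1 * normal_peak 1)%R.
Proof.
move=> s0; rewrite /normal_peak -mulrnAr sqrtrM ?sqr_ge0// sqrtr_sqr.
rewrite gtr0_norm//.
by rewrite invfM expr1n mul1r.
Qed.

Lemma normal_pdf_affine m s x : (0 < s)%R ->
  normal_pdf m s (m + s * x) = (s^-1 * normal_pdf 0 1 x)%R.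
Proof.
move=> s0; rewrite !normal_pdfE ?gt_eqF// normal_peakE// -mulrA.
congr (_ * (_ * _))%R.
rewrite /normal_fun; congr expR; field; by rewrite gt_eqF.
Qed.

Lemma ge0_integral_normal_affine m s F : (0 < s)%R ->
  measurable_fun setT F -> (forall x, 0 <= F x) ->
  \int[normal_prob 0 1]_x F (m + s * x)%R = \int[normal_prob m s]_x F x.
Proof.
move=> s0 mF F0; have s0' := ltW s0.
have mh : measurable_fun setT (fun x : R => m + s * x)%R.
  by apply: measurable_funD => //; exact: measurable_funM.
have mpdf (k l : R) : measurable_fun setT (fun x => (normal_pdf k l x)%:E).
  by apply/measurable_EFinP; exact: measurable_normal_pdf.
rewrite [RHS](ge0_integral_normal_prob m s mF F0).
rewrite [LHS](ge0_integral_normal_prob 0 1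
  (measurableT_comp mF mh) (fun=> F0 _)).
pose G x := F x * (normal_pdf m s x)%:E.
have mG : measurable_fun setT G := emeasurable_funM mF (mpdf _ _).
have G0 x : 0 <= G x by rewrite mule_ge0// lee_fin normal_pdf_ge0.
transitivity (\int[mu]_x (s%:E * G (m + s * x)%R)).
  apply: eq_integral => x _; rewrite /G normal_pdf_affine// muleCA -EFinM.
  by rewrite mulrA divff ?gt_eqF// mul1r.
rewrite ge0_integralZl//; last exact: measurableT_comp mG mh.
rewrite ge0_integral_lebesgue_affine// muleA -EFinM divff ?gt_eqF// mul1e.
by [].
Qed.

(** Both sides are the joint density of [x] and [u = a x + b y] for independent standard normal [x]
    and [y]: on the left the law of [x] times that of [u] given [x], on the right the law of [u]
    times that of [x] given [u]. *)
Lemma normal_pdf_convolution a b x u : (0 < a)%R -> (0 < b)%R ->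
  let r := Num.sqrt (a ^+ 2 + b ^+ 2) in
  (normal_pdf (a * x) b u * normal_pdf 0 1 x =
   normal_pdf 0 r u * normal_pdf (u * a / r ^+ 2) (b / r) x)%R.
Proof.
move=> a0 b0 r; have a20 : (0 < a ^+ 2)%R by rewrite exprn_gt0.
have b20 : (0 < b ^+ 2)%R by rewrite exprn_gt0.
have ab0 : (0 < a ^+ 2 + b ^+ 2)%R by rewrite addr_gt0.
have r0 : (0 < r)%R by rewrite sqrtr_gt0.
have r2 : (r ^+ 2 = a ^+ 2 + b ^+ 2)%R by rewrite sqr_sqrtr// ltW.
have br0 : (0 < b / r)%R by rewrite divr_gt0.
rewrite !normal_pdfE ?gt_eqF//.
rewrite (normal_peakE b0) (normal_peakE r0) (normal_peakE br0) /normal_fun.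
rewrite mulrACA [RHS]mulrACA -!expRD; congr (_ * expR _)%R.
  by field; rewrite !gt_eqF.
rewrite !exprMn !exprVn !r2.
by field; rewrite !gt_eqF//= ?gt_eqF.
Qed.

(** Lebesgue measure is invariant under negation and the density is even. *)
Lemma ge0_integral_normalN F :
  measurable_fun setT F -> (forall x, 0 <= F x) ->
  \int[normal_prob 0 1]_x F (- x)%R = \int[normal_prob 0 1]_x F x.
Proof.
move=> mF F0.
have mpdf (k l : R) : measurable_fun setT (fun x => (normal_pdf k l x)%:E).
  by apply/measurable_EFinP; exact: measurable_normal_pdf.
rewrite [RHS](ge0_integral_normal_prob 0 1 mF F0).
have mFN := measurableT_comp mF (@oppr_measurable R setT).
rewrite [LHS](ge0_integral_normal_prob 0 1 mFN (fun=> F0 _)).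
pose G x := F x * (normal_pdf 0 1 x)%:E.
have mG : measurable_fun setT G := emeasurable_funM mF (mpdf _ _).
have G0 x : 0 <= G x by rewrite mule_ge0// lee_fin normal_pdf_ge0.
pose h : measurableTypeR R -> measurableTypeR R := -%R.
have mh : measurable_fun setT h by exact: oppr_measurable.
transitivity (\int[pushforward mu h]_x G x).
  rewrite [RHS](ge0_integral_pushforward mh mu measurableT mG
    (fun _ _ => G0 _)).
  apply: eq_integral => x _.
  by rewrite /G/= !normal_pdfE// /normal_fun !subr0 sqrrN.
by apply: eq_measure_integral => A mA _; exact: lebesgue_measureN.
Qed.

Lemma ge0_integral_normal_scale c F :
  measurable_fun setT F -> (forall x, 0 <= F x) ->
  \int[normal_prob 0 1]_x F (c * x)%R = \int[normal_prob 0 1]_x F (`|c| * x)%R.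
Proof.
move=> mF F0; have [c0|c0] := leP 0%R c; first by rewrite ger0_norm.
rewrite ltr0_norm// -[RHS]ge0_integral_normalN//.
  by apply: eq_integral => x _; rewrite mulrNN.
by apply: measurableT_comp mF _; exact: measurable_funM.
Qed.

Lemma measurable_integral_normal_affine a b F :
  measurable_fun setT F -> (forall x, 0 <= F x) ->
  measurable_fun setT (fun x => \int[normal_prob 0 1]_y F (a * x + b * y)%R).
Proof.
move=> mF F0; apply: measurable_fun_ge0_integral => //.
apply: measurableT_comp mF _.
by apply: measurable_funD => //; apply: measurable_funM.
Qed.

(* For a, b > 0, integrate over the value u = a x + b y instead of y, exchange
   the integrals and complete the square in x. *)
Lemma ge0_integral_normal_rotation a b F :
  measurable_fun setT F -> (forall x, 0 <= F x) ->
  \int[normal_prob 0 1]_x \int[normal_prob 0 1]_y F (a * x + b * y)%R =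
  \int[normal_prob 0 1]_x F (Num.sqrt (a ^+ 2 + b ^+ 2) * x)%R.
Proof.
move=> mF F0.
have mFab (k l : R) : measurable_fun setT (fun x : R => F (k + l * x)%R).
  by apply: measurableT_comp mF _; apply: measurable_funD => //.
(* By symmetry of both normal laws only [|a|] and [|b|] matter; the sign of [b] is removed first,
   for fixed [x]. *)
wlog [a0 b0] : a b / (0 <= a /\ 0 <= b)%R.
  move=> H; rewrite -(real_normK (num_real a)) -(real_normK (num_real b)).
  rewrite -(H _ _ (conj (normr_ge0 a) (normr_ge0 b))).
  transitivity (\int[normal_prob 0 1]_x
      \int[normal_prob 0 1]_y F (a * x + `|b| * y)%R).
    apply: eq_integral => x _.
    apply: (@ge0_integral_normal_scale b (fun y => F (a * x + y)%R)) => //.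
    by have := mFab (a * x)%R 1%R; under eq_fun do rewrite mul1r.
  apply: (@ge0_integral_normal_scale a
    (fun z => \int[normal_prob 0 1]_y F (z + `|b| * y)%R)) => [|z].
    have := @measurable_integral_normal_affine 1 `|b| F mF F0.
    by under eq_fun do under eq_integral do rewrite mul1r.
  exact: integral_ge0.
(* In the degenerate cases [a = 0] and [b = 0] one of the two integrals is over a constant. *)
move: a0 b0; rewrite le_eqVlt => /predU1P[<- b0|a0].
  rewrite expr0n/= add0r sqrtr_sqr ger0_norm//.
  under eq_integral => x _ do under eq_integral => y _ do rewrite mul0r add0r.
  by rewrite integral_cst//= [normal_prob _ _ _]probability_setT mule1.
rewrite le_eqVlt => /predU1P[<-|b0].
  rewrite expr0n/= addr0 sqrtr_sqr gtr0_norm//.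
  apply: eq_integral => x _; under eq_integral => y _ do rewrite mul0r addr0.
  by rewrite integral_cst//= [normal_prob _ _ _]probability_setT mule1.
set r := Num.sqrt _.
have r0 : (0 < r)%R by rewrite sqrtr_gt0 addr_gt0// exprn_gt0.
have pdf0 (m s x : R) : 0 <= (normal_pdf m s x)%:E.
  by rewrite lee_fin normal_pdf_ge0.
(* A moving mean becomes a shift of the argument, which makes the density jointly measurable in [x]
   and [u]. *)
have pdf_center (m s x : R) : s != 0%R ->
    normal_pdf m s x = normal_pdf 0 s (x - m)%R.
  by move=> s0; rewrite !normal_pdfE// /normal_fun subr0.
have mpdf (m s : R) : measurable_fun setT (fun x => (normal_pdf m s x)%:E).
  by apply/measurable_EFinP; exact: measurable_normal_pdf.
transitivity (\int[mu]_x \int[mu]_u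
    (F u * (normal_pdf (a * x) b u * normal_pdf 0 1 x)%:E)).
  rewrite [LHS](ge0_integral_normal_prob 0 1
    (measurable_integral_normal_affine a b mF F0)
    (fun=> integral_ge0 _ (fun _ _ => F0 _))).
  apply: eq_integral => x _.
  rewrite (ge0_integral_normal_affine (a * x)%R b0 mF F0).
  rewrite (ge0_integral_normal_prob (a * x)%R b mF F0).
  rewrite -ge0_integralZr//.
  - by apply: eq_integral => u _; rewrite EFinM muleA.
  - exact: emeasurable_funM mF (mpdf _ _).
  - by move=> u _; exact: mule_ge0.
have mF2 : measurable_fun setT (fun p : R * R => F p.2).
  by apply: measurableT_comp mF _.
rewrite [LHS]ge0_integral_exchange; last 2 first.
- apply: emeasurable_funM mF2 _; apply/measurable_EFinP/measurable_funM.
    under eq_fun do rewrite pdf_center ?gt_eqF//.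
    apply: measurableT_comp (measurable_normal_pdf _ _) _.
    by apply: measurable_funB => //; exact: measurable_funM.
  exact: measurableT_comp (measurable_normal_pdf _ _) _.
- by move=> x u; rewrite mule_ge0// lee_fin mulr_ge0// normal_pdf_ge0.
have -> : \int[normal_prob 0 1]_x F (r * x)%R = \int[normal_prob 0 r]_x F x.
  rewrite -(ge0_integral_normal_affine 0 r0 mF F0).
  by apply: eq_integral => x _; rewrite add0r.
rewrite [RHS](ge0_integral_normal_prob 0 r mF F0).
apply: eq_integral => u _.
(* The conditional density of [x] given [u] integrates to 1, which leaves the density of [u]. *)
under eq_integral => x _ do rewrite normal_pdf_convolution// EFinM muleA.
rewrite ge0_integralZl//; [|exact: mpdf|exact: mule_ge0].
by rewrite integral_normal_pdf mule1.
Qed.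

End normal_integral.

(** * Tails, positive part and interval probabilities of N(0, 1) *)

Section standard_normal.
Local Open Scope ereal_scope.
Context {R : realType}.
Local Notation mu := (@lebesgue_measure R).
Implicit Types (s t a b : R).

(** Reflection turns the event into [x < - t]; as the law has a density, including the endpoint
    changes nothing. *)
Lemma normal_prob_gt t :
  normal_prob 0 1 [set x : R | (t < x)%R] = (Phi (- t))%:E.
Proof.
rewrite /Phi fineK ?fin_num_measure//.
have mA : measurable [set x : R | (t < x)%R].
  by have := measurable_itv `]t, +oo[; rewrite set_itvoy.
have mB : measurable [set x : R | (x < - t)%R].
  by have := measurable_itv `]-oo, (- t)%R[; rewrite set_itvNyo.
transitivity (normal_prob 0 1 [set x : R | (x < - t)%R]).
  have indE (A : set R) : measurable A ->
      normal_prob 0 1 A = \int[normal_prob 0 1]_x (\1_A x)%:E.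
    by move=> ?; rewrite integral_indic// setIT.
  rewrite (indE _ mA) (indE _ mB) -[LHS]ge0_integral_normalN.
  - apply: eq_integral => x _; rewrite !indicE; congr ((nat_of_bool _)%:R%:E).
    by apply/idP/idP; rewrite !inE/= ltrNr.
  - exact/measurable_EFinP/measurable_indic.
  - by move=> x; rewrite lee_fin.
rewrite -set_itvNyo /normal_prob integral_itv_bndo_bndc//.
by apply/measurable_EFinP/measurable_funTS; exact: measurable_normal_pdf.
Qed.

Lemma PhiN t : (Phi (- t) = 1 - Phi t)%R.
Proof.
apply: EFin_inj; rewrite -normal_prob_gt EFinB /Phi fineK ?fin_num_measure//.
rewrite -probability_setC//; congr (normal_prob _ _ _).
by rewrite set_itvNyc; apply/seteqP; split => x /=; rewrite ltNge => /negP.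
Qed.

(** On the half-line, [x * normal_pdf 0 1 x] is the derivative of [- normal_pdf 0 1], which vanishes
    at infinity and is minus the peak [1 / sqrt (2 pi)] at 0. *)
Lemma integral_normal_pos_part :
  \int[normal_prob 0 1]_x (Num.max x 0)%:E = (normal_peak (1 : R))%:E.
Proof.
have mpdf : measurable_fun setT (fun x => (normal_pdf 0 1 x)%:E : \bar R).
  by apply/measurable_EFinP; exact: measurable_normal_pdf.
have mmax : measurable_fun setT (fun x : R => (Num.max x 0)%:E).
  by apply/measurable_EFinP; exact: measurable_maxr.
rewrite (ge0_integral_normal_prob _ _ mmax); last first.
  by move=> x; rewrite lee_fin le_max lexx orbT.
transitivity (\int[mu]_(x in `[0%R, +oo[) (x * normal_pdf 0 1 x)%:E).
  rewrite [RHS]integral_mkcond; apply: eq_integral => x _.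
  rewrite patchE; case: ifPn.
    by rewrite inE/= in_itv/= andbT => x0; rewrite max_l.
  rewrite notin_setE/= in_itv/= andbT => /negP; rewrite -ltNge => x0.
  by rewrite max_r ?mul0e// ltW.
pose p : R := normal_peak 1.
(* This is minus the density, composed of operations through which the derivative can be
   inferred. *)
pose F : R -> R := ((- p) \*: (expR \o ((- 2^-1 : R) \*: (id ^+ 2))))%R.
have FE x : (F x = - normal_pdf 0 1 x)%R.
  rewrite /F/= normal_pdfE//= /normal_fun subr0 expr1n/= -mulNr.
  by congr (_ * expR _)%R; rewrite /GRing.scale/= fctE; field.
have dF (x : R) : is_derive x (1%R : R) F (x * normal_pdf 0 1 x)%R.
  apply: is_derive_eq; rewrite normal_pdfE//= /normal_fun subr0 expr1n/=.
  rewrite /GRing.scale/= fctE/= mulr1 expr1.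
  have -> : (- x ^+ 2 / 2 = - 2^-1 * x ^+ 2)%R by field.
  rewrite /p.
  by field.
rewrite (@ge0_continuous_FTC2y R (fun x => x * normal_pdf 0 1 x)%R F 0 0).
- rewrite FE normal_pdfE//= /normal_fun subr0 expr0n/= oppr0 mul0r expR0 mulr1.
  by rewrite -EFinB sub0r opprK.
- by move=> x x0; rewrite mulr_ge0// normal_pdf_ge0.
- apply: continuous_subspaceT => x; apply: cvgM; first exact: cvg_id.
  exact: continuous_normal_pdf.
- rewrite -(mulr0 (- p)%R); apply: cvgM; first exact: cvg_cst.
  rewrite (_ : _ \o _ = fun x => expR (- (2^-1 * x ^+ 2)))%R; last first.
    by apply/funext => x /=; rewrite /GRing.scale/= fctE mulNr.
  apply: (cvg_comp (fun x : R => 2^-1 * x ^+ 2)%R (fun x => expR (- x)%R));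
    last exact: cvgr_expR.
  apply: gt0_cvgMry => //; exact: cvgr_expr2.
- by move=> x _; have [] := dF x.
- apply: cvg_at_right_filter; apply: differentiable_continuous.
  by apply/derivable1_diffP; by have [] := dF 0%R.
- by move=> x _; rewrite derive1E; exact: derive_val.
Qed.

(** The density is at most its peak and the interval has length [(b - a) / s]; the maximum with 0
    covers the empty interval. *)
Lemma normal_prob_interval_le s a b : (0 < s)%R ->
  normal_prob 0 1 [set x | a < s * x <= b]%R <=
  (normal_peak 1 / s * Num.max (b - a) 0)%:E.
Proof.
move=> s0.
have -> : [set x | a < s * x <= b]%R = [set` `](a / s)%R, (b / s)%R]].
  by apply/seteqP; split => x /=;
    rewrite in_itv/= ltr_pdivrMr// ler_pdivlMr// ![(x * s)%R]mulrC.
apply: (@le_trans _ _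
  (\int[mu]_(x in `](a / s)%R, (b / s)%R]) (normal_peak 1)%:E)).
  apply: ge0_le_integral => //=.
  - by move=> x _; rewrite lee_fin normal_pdf_ge0.
  - by apply/measurable_EFinP/measurable_funTS; exact: measurable_normal_pdf.
  - by move=> x _; rewrite lee_fin normal_pdf_ub.
rewrite integral_cst//= lebesgue_measure_itv/= lte_fin ltr_pM2r ?invr_gt0//.
case: ltP => ab; last first.
  by rewrite mule0 lee_fin !mulr_ge0 ?normal_peak_ge0 ?invr_ge0 ?le_max ?lexx
    ?orbT// ltW.
rewrite -EFinB -EFinM lee_fin -mulrBl max_l; last by rewrite subr_ge0 ltW.
by rewrite mulrA mulrAC.
Qed.
End standard_normal.

(** * Integrals against the standard Gaussian measure *)

Section std_gaussian_integral.
Local Open Scope ereal_scope.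
Context {R : realType}.
Local Notation N01 := (normal_prob (0 : R) 1).

Lemma ge0_integral_std_gaussianS d (F : d.+1.-tuple R -> \bar R) :
  measurable_fun setT F -> (forall x, 0 <= F x) ->
  \int[std_gaussian d.+1]_x F x =
  \int[N01]_y \int[std_gaussian d]_x F (cons_pair (y, x)).
Proof.
move=> mF F0; rewrite /= ge0_integral_distribution//.
have mFc := measurableT_comp mF (@measurable_cons_pair R d).
exact: (@fubini_tonelli1 _ _ _ _ _ N01 (std_gaussian d) _ mFc (fun=> F0 _)).
Qed.

(** By induction, the coordinates after the first merge into one normal variable, which
    [ge0_integral_normal_rotation] combines with the first. *)
Lemma ge0_integral_std_gaussian_linear d (theta : 'I_d -> R) (F : R -> \bar R) :
  measurable_fun setT F -> (forall x, 0 <= F x) ->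
  \int[std_gaussian d]_x F (\sum_(i < d) theta i * tnth x i)%R =
  \int[N01]_z F (Num.sqrt (\sum_(i < d) theta i ^+ 2) * z)%R.
Proof.
have mlin n (t : 'I_n -> R) :
    measurable_fun setT (fun x : n.-tuple R => \sum_(i < n) t i * tnth x i)%R.
  apply: measurable_sum => i; apply: measurable_funM => //.
  exact: measurable_tnth.
elim: d theta F => [|d IH] theta F mF F0.
  rewrite big_ord0 sqrtr0 /= integral_dirac//; last first.
    exact: measurableT_comp mF (mlin _ _).
  rewrite diracT mul1e big_ord0; under eq_integral do rewrite mul0r.
  by rewrite integral_cst//= [normal_prob _ _ _]probability_setT mule1.
rewrite ge0_integral_std_gaussianS//;
  last exact: measurableT_comp mF (mlin _ _).
pose r := Num.sqrt (\sum_(i < d) theta (lift ord0 i) ^+ 2).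
transitivity (\int[N01]_y \int[N01]_z F (theta ord0 * y + r * z)%R).
  apply: eq_integral => y _.
  rewrite -(IH (fun i => theta (lift ord0 i))
    (fun z => F (theta ord0 * y + z)%R))//.
    apply: eq_integral => x _; rewrite big_ord_recl; congr F.
    by congr (_ + _)%R; apply: eq_bigr => i _; rewrite tnthS.
  by apply: measurableT_comp mF _; exact: measurable_funD.
rewrite ge0_integral_normal_rotation// big_ord_recl sqr_sqrtr//.
by apply: sumr_ge0 => i _; exact: sqr_ge0.
Qed.

End std_gaussian_integral.

(** * Swapping coordinates between two independent Gaussian vectors *)

Section coordinate_swap.
Local Open Scope ereal_scope.
Context {R : realType}.
Local Notation N01 := (normal_prob (0 : R) 1).

(** For an independent copy [z], this is [x] with the coordinates outside [u] resampled; [mix u x z]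
    and [mix u z x] together form the pair [x], [z] with those coordinates swapped. *)
Definition mix d (u : pred 'I_d) (x z : d.-tuple R) : d.-tuple R :=
  [tuple if u i then tnth x i else tnth z i | i < d].

Lemma tnth_mix d (u : pred 'I_d) x z i :
  tnth (mix u x z) i = if u i then tnth x i else tnth z i.
Proof. by rewrite tnth_mktuple. Qed.

Lemma mix_cons d (u : pred 'I_d.+1) y x y' z :
  mix u (cons_pair (y, x)) (cons_pair (y', z)) =
  cons_pair (if u ord0 then y else y', mix (u \o lift ord0) x z).
Proof.
apply: eq_from_tnth => i; rewrite tnth_mix.
by have [j ->|->] := unliftP ord0 i; rewrite ?tnthS ?tnth_mix//= !tnthS.
Qed.

Lemma measurable_mix d (u : pred 'I_d) d' (X : measurableType d')
    (f g : X -> d.-tuple R) :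
  measurable_fun setT f -> measurable_fun setT g ->
  measurable_fun setT (fun x => mix u (f x) (g x)).
Proof.
move=> mf mg; apply/measurable_fun_tnthP => i.
under [X in measurable_fun _ X]eq_fun do rewrite /= tnth_mix.
by case: (u i); [apply: (measurableT_comp (@measurable_tnth _ _ _ i) mf)|
  apply: (measurableT_comp (@measurable_tnth _ _ _ i) mg)].
Qed.

Lemma ge0_integral_std_gaussianS2 d
    (F : d.+1.-tuple R -> d.+1.-tuple R -> \bar R) :
  measurable_fun setT (fun p : d.+1.-tuple R * d.+1.-tuple R => F p.1 p.2) ->
  (forall x z, 0 <= F x z) ->
  \int[std_gaussian d.+1]_x \int[std_gaussian d.+1]_z F x z =
  \int[N01]_y \int[N01]_y' \int[std_gaussian d]_x \int[std_gaussian d]_z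
    F (cons_pair (y, x)) (cons_pair (y', z)).
Proof.
move=> mF F0.
have mFc d' (X : measurableType d') (f g : X -> d.+1.-tuple R) :
    measurable_fun setT f -> measurable_fun setT g ->
    measurable_fun setT (fun x => F (f x) (g x)).
  by move=> mf mg; exact: (measurableT_comp mF (measurable_fun_pair mf mg)).
rewrite ge0_integral_std_gaussianS; last 2 first.
- exact: measurable_fun_ge0_integral.
- by move=> x; exact: integral_ge0.
apply: eq_integral => y _.
transitivity (\int[std_gaussian d]_x \int[N01]_y' \int[std_gaussian d]_z
    F (cons_pair (y, x)) (cons_pair (y', z))).
  apply: eq_integral => x _; rewrite ge0_integral_std_gaussianS//.
  exact: mFc.
rewrite ge0_integral_exchange//; last by move=> *; exact: integral_ge0.
apply: (@measurable_fun_ge0_integral _ _ _ _ _ _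
  (fun (p : d.-tuple R * measurableTypeR R) z =>
   F (cons_pair (y, p.1)) (cons_pair (p.2, z)))) => //.
apply: mFc.
  exact: (measurable_cons (measurable_cst _)
    (measurableT_comp measurable_fst measurable_fst)).
exact: (measurable_cons (measurableT_comp measurable_snd measurable_fst)
  measurable_snd).
Qed.

(** The two i-th coordinates are exchangeable for every i, independently of the others; the
    induction peels off the first coordinate of both vectors. *)
Lemma ge0_integral_mix d (u : pred 'I_d)
    (F : d.-tuple R -> d.-tuple R -> \bar R) :
  measurable_fun setT (fun p : d.-tuple R * d.-tuple R => F p.1 p.2) ->
  (forall x z, 0 <= F x z) ->
  \int[std_gaussian d]_x \int[std_gaussian d]_z F (mix u x z) (mix u z x) =
  \int[std_gaussian d]_x \int[std_gaussian d]_z F x z.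
Proof.
elim: d u F => [|d IH] u F mF F0.
  apply: eq_integral => x _; apply: eq_integral => z _;
  by rewrite (tuple0 x) (tuple0 z) (tuple0 (mix _ _ _)).
have mFc d' (X : measurableType d') (f g : X -> d.+1.-tuple R) :
    measurable_fun setT f -> measurable_fun setT g ->
    measurable_fun setT (fun x => F (f x) (g x)).
  by move=> mf mg; exact: (measurableT_comp mF (measurable_fun_pair mf mg)).
rewrite [LHS]ge0_integral_std_gaussianS2; last 2 first.
- by apply: mFc; exact: measurable_mix.
- by move=> *; exact: F0.
rewrite [RHS](ge0_integral_std_gaussianS2 mF F0).
have mcons d' (X : measurableType d') (f : X -> R) (g : X -> d.-tuple R) :
    measurable_fun setT f -> measurable_fun setT g ->
    measurable_fun setT (fun x => cons_pair (f x, g x)).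
  by move=> mf mg; exact: measurable_cons.
transitivity (\int[N01]_y \int[N01]_y'
    \int[std_gaussian d]_x \int[std_gaussian d]_z
    F (cons_pair (if u ord0 then y else y', x))
      (cons_pair (if u ord0 then y' else y, z))).
  apply: eq_integral => y _; apply: eq_integral => y' _.
  rewrite -[RHS](IH (u \o lift ord0) (fun x z =>
    F (cons_pair (if u ord0 then y else y', x))
      (cons_pair (if u ord0 then y' else y, z)))); last 2 first.
  - by apply: mFc; exact: mcons.
  - by move=> *; exact: F0.
  - apply: eq_integral => x _; apply: eq_integral => z _.
    by rewrite !mix_cons.
(* If the first coordinate is not in [u], swapping [y] and [y'] amounts to exchanging the two outer
   integrals. *)
case: (u ord0); first by [].
rewrite [LHS]ge0_integral_exchange; [by []| |]; last first.
  by move=> x y; apply: integral_ge0 => ? _; exact: integral_ge0.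
apply: (@measurable_fun_ge0_integral _ _ _ _ _ _
  (fun (p : measurableTypeR R * measurableTypeR R) x =>
  \int[std_gaussian d]_z F (cons_pair (p.2, x)) (cons_pair (p.1, z))));
  last by move=> p x; apply: integral_ge0 => z _; exact: F0.
apply: (@measurable_fun_ge0_integral _ _ _ _ _ _
  (fun (p : (measurableTypeR R * measurableTypeR R) * d.-tuple R) z =>
  F (cons_pair (p.1.2, p.2)) (cons_pair (p.1.1, z))));
  last by move=> *; exact: F0.
apply: mFc; apply: mcons => //.
- exact: (measurableT_comp measurable_snd
    (measurableT_comp measurable_fst measurable_fst)).
- exact: (measurableT_comp measurable_snd measurable_fst).
- exact: (measurableT_comp measurable_fst
    (measurableT_comp measurable_fst measurable_fst)).
Qed.

End coordinate_swap.

(** * Averages as conditional expectations *)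

Lemma mem_bigsetU (I : finType) T (Q : pred I) (F : I -> set T) x :
  (\big[setU/set0]_(i | Q i) F i) x -> exists2 i, Q i & F i x.
Proof.
elim/big_ind: _ => [[]|A B hA hB [/hA|/hB]|i Qi Fx] //.
by exists i.
Qed.

Section averaging.
Local Open Scope ereal_scope.
Context {R : realType} {d : nat}.
Local Notation P := (@std_gaussian R d).
Implicit Types (f g : d.-tuple R -> R) (u v w : {set 'I_d}).

(** A class of integrable functions that contains the ridge step function and the indicators of
    measurable sets and is stable under [average]. *)
Definition measurable_unit f :=
  measurable_fun setT f /\ forall x, (0 <= f x <= 1)%R.

Definition average u f (x : d.-tuple R) : R :=
  fine (\int[P]_z (f (mix (mem u) x z))%:E).

Lemma measurable_unit_mix u f : measurable_unit f ->
  measurable_fun setT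
    (fun p : d.-tuple R * d.-tuple R => (f (mix (mem u) p.1 p.2))%:E).
Proof.
move=> [mf _]; apply/measurable_EFinP; apply: measurableT_comp mf _.
exact: measurable_mix.
Qed.

Lemma averageE u f x : measurable_unit f ->
  (average u f x)%:E = \int[P]_z (f (mix (mem u) x z))%:E.
Proof.
move=> uf; have [mf f01] := uf; rewrite fineK// ge0_fin_numE; last first.
  by apply: integral_ge0 => z _; rewrite lee_fin;
    case/andP: (f01 (mix (mem u) x z)).
apply: (@le_lt_trans _ _ (\int[P]_z 1%:E)); last first.
  by rewrite integral_cst//= probability_setT mule1 ltry.
apply: ge0_le_integral => //=.
- by move=> z _; rewrite lee_fin;
    case/andP: (f01 (mix (mem u) x z)).
- apply/measurable_EFinP; apply: measurableT_comp mf _.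
  by apply: measurable_mix => //; exact: measurable_cst.
- by move=> z _; rewrite lee_fin;
    case/andP: (f01 (mix (mem u) x z)).
Qed.

Lemma measurable_unit_average u f : measurable_unit f ->
  measurable_unit (average u f).
Proof.
move=> uf; have [mf f01] := uf; split.
  apply/measurable_EFinP.
  under [X in measurable_fun _ X]eq_fun do rewrite /= averageE//.
  apply: measurable_fun_ge0_integral; first exact: measurable_unit_mix.
  by move=> x z; rewrite lee_fin; case/andP: (f01 (mix (mem u) x z)).
move=> x; rewrite -!lee_fin averageE//; apply/andP; split.
  by apply: integral_ge0 => z _; rewrite lee_fin;
    case/andP: (f01 (mix (mem u) x z)).
apply: (@le_trans _ _ (\int[P]_z 1%:E)); last first.
  by rewrite integral_cst//= probability_setT mule1.
apply: ge0_le_integral => //=.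
- by move=> z _; rewrite lee_fin;
    case/andP: (f01 (mix (mem u) x z)).
- apply/measurable_EFinP; apply: measurableT_comp mf _.
  by apply: measurable_mix => //; exact: measurable_cst.
- by move=> z _; rewrite lee_fin;
    case/andP: (f01 (mix (mem u) x z)).
Qed.

(** Since [mix u (mix u x z) (mix u z x) = x], the left integrand is [F] at the swapped pair, where
    [F x z = f x * g (mix u x z)]. *)
Lemma average_self_adjoint u f g : measurable_unit f -> measurable_unit g ->
  \int[P]_x (average u f x * g x)%:E = \int[P]_x (f x * average u g x)%:E.
Proof.
move=> uf ug; have [mf f01] := uf; have [mg g01] := ug.
have f0 x : 0 <= (f x)%:E by rewrite lee_fin; case/andP: (f01 x).
have g0 x : 0 <= (g x)%:E by rewrite lee_fin; case/andP: (g01 x).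
pose F x z := (f x)%:E * (g (mix (mem u) x z))%:E.
transitivity (\int[P]_x \int[P]_z F (mix (mem u) x z) (mix (mem u) z x)).
  apply: eq_integral => x _; rewrite EFinM averageE// -ge0_integralZr//;
      last first.
    apply/measurable_EFinP; apply: measurableT_comp mf _.
    by apply: measurable_mix => //; exact: measurable_cst.
  apply: eq_integral => z _; rewrite /F; congr (_ * (g _)%:E).
  by apply: eq_from_tnth => i; rewrite !tnth_mix; case: ifP => // ->.
rewrite ge0_integral_mix//; last 2 first.
- apply: emeasurable_funM; last exact: measurable_unit_mix.
  by apply/measurable_EFinP; exact: measurableT_comp mf _.
- by move=> x z; rewrite mule_ge0.
apply: eq_integral => x _; rewrite EFinM averageE// -ge0_integralZl//.
apply/measurable_EFinP; apply: measurableT_comp mg _.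
by apply: measurable_mix => //; exact: measurable_cst.
Qed.

(** Resampling from [y] outside [u] and then from [z] outside [v] involves [y] and [z] only through
    [mix v y z], which is distributed like [y]. *)
Lemma average_average u v f : measurable_unit f ->
  average u (average v f) =1 average (u :&: v) f.
Proof.
move=> uf x; have [mf f01] := uf.
have f0 y : 0 <= (f y)%:E by rewrite lee_fin; case/andP: (f01 y).
apply: EFin_inj; rewrite !averageE//; last exact: measurable_unit_average.
pose F (y : d.-tuple R) (z : d.-tuple R) := (f (mix (mem (u :&: v)) x y))%:E.
transitivity (\int[P]_y \int[P]_z F (mix (mem v) y z) (mix (mem v) z y)).
  apply: eq_integral => y _; rewrite averageE//.
  apply: eq_integral => z _; rewrite /F; congr (f _)%:E.
  apply: eq_from_tnth => i; rewrite !tnth_mix /= inE.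
  by case: (i \in u); case: (i \in v).
have mF (y : d.-tuple R) :
    measurable_fun setT (fun z => f (mix (mem (u :&: v)) y z)).
  apply: measurableT_comp mf _.
  by apply: measurable_mix => //; exact: measurable_cst.
rewrite ge0_integral_mix; last 2 first.
- by apply/measurable_EFinP; exact: measurableT_comp (mF x) _.
- by move=> y z; exact: f0.
apply: eq_integral => y _.
by rewrite /F integral_cst//= probability_setT mule1.
Qed.

Lemma sigma_coord_measurable u (A : set (d.-tuple R)) :
  sigma_coord u A -> measurable A.
Proof.
apply: smallest_sub; first exact: sigma_algebra_measurable.
move=> B hB; have [i _ [C mC <-]] := mem_bigsetU hB.
exact: measurable_tnth.
Qed.

(** The sets that ignore the coordinates outside [u] form a sigma-algebra, and it contains the
    generators. *)
Lemma sigma_coord_mix u (A : set (d.-tuple R)) : sigma_coord u A ->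
  forall x z, A (mix (mem u) x z) = A x.
Proof.
apply: (@smallest_sub _ _ _ [set A | forall x z, A (mix (mem u) x z) = A x]).
  split; first by [].
    by move=> B /= HB x z; rewrite /setD/= HB.
  by move=> F HF x z; apply/propext; split => -[k _ Fk];
    exists k => //; move: Fk; rewrite HF.
move=> B hB; have [i iu [C mC <-]] := mem_bigsetU hB; move=> x z /=.
by rewrite tnth_mix /= iu.
Qed.

(** Each coordinate of this map is a generating projection or a constant. A measurable function that
    ignores the coordinates outside [u] factors through it and is thus measurable for
    [sigma_coord u]. *)
Lemma measurable_sigma_coord_mix u z : measurable_fun setT
  ((fun x => mix (mem u) x z) : g_sigma_algebraType (\big[setU/set0]_(j in u)
    preimage_set_system setT (fun x : d.-tuple R => tnth x j) measurable) -> _).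
Proof.
apply/measurable_fun_tnthP => i; have [iu|/negbTE iu] := boolP (i \in u);
  under [X in measurable_fun _ X]eq_fun do rewrite /= tnth_mix /= iu;
  last exact: measurable_cst.
move=> _ A mA; rewrite setTI; apply: sub_sigma_algebra.
rewrite (bigD1 i)//=; left; exists A => //; exact: setTI.
Qed.

Lemma integrable_measurable_unit f : measurable_unit f ->
  P.-integrable setT (EFin \o f).
Proof.
move=> [mf f01]; apply/integrableP; split; first exact/measurable_EFinP.
apply: (@le_lt_trans _ _ (\int[P]_z 1%:E)); last first.
  by rewrite integral_cst//= probability_setT mule1 ltry.
apply: ge0_le_integral => //=.
- by apply/measurable_EFinP/measurableT_comp.
- by move=> x _; case/andP: (f01 x) => f0 f1; rewrite lee_fin ger0_norm.
Qed.

Lemma average_mix u f x z : average u f (mix (mem u) x z) = average u f x.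
Proof.
rewrite /average; congr fine; apply: eq_integral => y _; congr (f _)%:E.
by apply: eq_from_tnth => i; rewrite !tnth_mix; case: ifP => // ->.
Qed.

(** For the integral identity: the indicator of a set in [sigma_coord u] is its own average, so
    self-adjointness moves the average from [f] onto it. *)
Lemma is_cond_exp_average u f : measurable_unit f ->
  is_cond_exp P (sigma_coord u) f (average u f).
Proof.
move=> uf; have [mf f01] := uf; have [ma a01] := measurable_unit_average u uf.
split.
- move=> B mB; have mB' := ma measurableT B mB.
  (* Any fixed values for the coordinates outside [u] would do. *)
  pose z0 : d.-tuple R := nseq_tuple d (0%R : R).
  have := @measurable_sigma_coord_mix u z0 measurableT _ mB'.
  rewrite !setTI (_ : _ @^-1` (_ @^-1` _) = average u f @^-1` B)//.
  by apply/seteqP; split => x /=; rewrite average_mix.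
- exact/integrable_measurable_unit/measurable_unit_average.
- move=> A GA; have mA := sigma_coord_measurable GA.
  have uA : measurable_unit (\1_A : _ -> R).
    split; first exact: measurable_indic.
    by move=> x; rewrite indicE; case: (_ \in _); rewrite ?lexx ?ler01.
  have indE (h : d.-tuple R -> R) :
      \int[P]_(x in A) (h x)%:E = \int[P]_x (h x * \1_A x)%:E.
    rewrite integral_mkcond; apply: eq_integral => x _.
    by rewrite patchE indicE; case: ifP; rewrite ?mulr1 ?mulr0.
  rewrite !indE average_self_adjoint//; apply: eq_integral => x _.
  congr (_ * _)%:E; apply: EFin_inj; rewrite averageE//.
  under eq_integral => z _.
    rewrite indicE (_ : (_ \in A) = (x \in A)); last first.
      by apply/idP/idP; rewrite !inE (sigma_coord_mix GA).
    over.
  by rewrite integral_cst//= probability_setT mule1 indicE.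
Qed.

(** The set where [l < k] lies in the sigma-algebra, so [k] and [l] have the same integral over it;
    as [k - l] is positive there, the set is null. *)
Lemma is_cond_exp_ae_unique u f g h : is_cond_exp P (sigma_coord u) f g ->
  is_cond_exp P (sigma_coord u) f h -> ae_eq P setT (EFin \o g) (EFin \o h).
Proof.
have sub k l : is_cond_exp P (sigma_coord u) f k ->
    is_cond_exp P (sigma_coord u) f l -> {ae P, forall x, (k x <= l x)%R}.
  move=> [mk ik kf] [ml il lf].
  pose G := (\big[setU/set0]_(j in u)
    preimage_set_system setT (fun x : d.-tuple R => tnth x j) measurable).
  have mk' : measurable_fun setT (k : g_sigma_algebraType G -> R).
    by move=> _ B mB; rewrite setTI; exact: mk.
  have ml' : measurable_fun setT (l : g_sigma_algebraType G -> R).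
    by move=> _ B mB; rewrite setTI; exact: ml.
  pose A := [set x | (l x < k x)%R].
  have GA : sigma_coord u A.
    have := @measurable_fun_ltr _ (g_sigma_algebraType G) _ _ _ _ ml' mk'
      measurableT [set true] I.
    by rewrite setTI.
  have mA := sigma_coord_measurable GA.
  have iA (m : d.-tuple R -> R) : P.-integrable setT (EFin \o m) ->
      P.-integrable A (EFin \o m).
    by move=> im; exact: integrableS im.
  have mkl : measurable_fun A (fun x => (k x)%:E - (l x)%:E).
    by apply: emeasurable_funB; apply: measurable_int; exact: iA.
  have : \int[P]_(x in A) `|(k x)%:E - (l x)%:E| = 0.
    transitivity (\int[P]_(x in A) ((k x)%:E - (l x)%:E)).
      apply: eq_integral => x; rewrite inE => Ax.
      by rewrite gee0_abs// -EFinB lee_fin subr_ge0 ltW.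
    rewrite (integralB mA (iA _ ik) (iA _ il)) kf// lf//.
    by rewrite subee// -kf//; apply: integrable_fin_num => //; exact: iA.
  move/(ae_eq_integral_abs _ mA mkl); apply: filterS => x Ax0.
  rewrite leNgt; apply/negP => lk; have := Ax0 lk.
  rewrite -EFinB => -[] /eqP; rewrite subr_eq0 => /eqP kl.
  by rewrite kl ltxx in lk.
move=> fg fh; apply: filterS2 (sub _ _ fg fh) (sub _ _ fh fg) => x gh hg _.
by congr EFin; apply/eqP; rewrite eq_le gh.
Qed.

Lemma cond_exp_average u f : measurable_unit f ->
  ae_eq P setT (EFin \o cond_exp P f u) (EFin \o average u f).
Proof.
move=> uf; apply: (@is_cond_exp_ae_unique u f); last exact: is_cond_exp_average.
rewrite /cond_exp; case: xgetP => [g _ //|/(_ (average u f))[]].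
exact: is_cond_exp_average.
Qed.

End averaging.

(** * Orthogonality of the ANOVA components *)

Section subset_sums.
Context {R : realType} {T : finType}.
Implicit Types (u v w : {set T}) (g M : {set T} -> R).

(* The recursion of [anova_rec] at a fixed point x, for an arbitrary family of
   values in place of the conditional expectations at x. *)
Fixpoint mobius_rec n g u : R :=
  if n is n'.+1 then g u - \sum_(v : {set T} | v \proper u) mobius_rec n' g v
  else 0.

Definition mobius g u : R := mobius_rec #|u|.+1 g u.

Lemma mobius_rec_fuel n m g u :
  (#|u| < n)%N -> (#|u| < m)%N -> mobius_rec n g u = mobius_rec m g u.
Proof.
elim: n m u => [|n IHn] [|m] u //; rewrite !ltnS => un um /=.
congr (_ - _); apply: eq_bigr => v /proper_card vu.
by apply: IHn; exact: leq_trans vu _.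
Qed.

Lemma big_subset_proper (F : {set T} -> R) u :
  \sum_(v : {set T} | v \subset u) F v =
  F u + \sum_(v : {set T} | v \proper u) F v.
Proof.
rewrite (bigD1 u)//=; congr (_ + _); apply: eq_bigl => v.
by rewrite finset.properEneq andbC.
Qed.

Lemma sum_mobius g u : \sum_(v : {set T} | v \subset u) mobius g v = g u.
Proof.
rewrite big_subset_proper {1}/mobius /=.
rewrite -addrA [X in _ + X](_ : _ = 0) ?addr0//.
apply/eqP; rewrite addrC subr_eq0; apply/eqP.
apply: eq_bigr => v /proper_card vu.
exact: mobius_rec_fuel.
Qed.

(* In the application, M u = <f, A_u f>, A u v = <f_u, A_v f> and
   C u v = <f_u, f_v>. *)
Variables (A C : {set T} -> {set T} -> R) (M : {set T} -> R).
Hypothesis AM : forall u w,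
  \sum_(v : {set T} | v \subset u) A v w = M (u :&: w).
Hypothesis CA : forall u v, \sum_(w : {set T} | w \subset v) C u w = A u v.
Hypothesis Csym : forall u v, C u v = C v u.

(** Strong induction on the size of [u]. In [AM u w] the proper subsets of [u] not inside [w]
    contribute 0; the others are exactly the subsets of [u :&: w], whose terms already add up to
    [M (u :&: w)]. Nothing is left for [u] itself. *)
Lemma subset_sums_cross0 u w : ~~ (u \subset w) -> A u w = 0.
Proof.
have [n] := ubnP #|u|; elim: n u => // n IH u; rewrite ltnS => un uw.
have := AM u w; rewrite big_subset_proper => /(canRL (addrK _)) ->.
apply/eqP; rewrite subr_eq0; apply/eqP; symmetry.
rewrite (bigID (fun v => v \subset w))/= [X in _ + X]big1 ?addr0; last first.
  move=> v /andP[/proper_card vu vw]; apply: IH => //; exact: leq_trans vu un.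
rewrite -[in RHS](finset.setIid w) finset.setIA -AM; apply: eq_bigl => v.
rewrite finset.subsetI finset.properEneq.
have [vw|] := boolP (v \subset w); rewrite ?andbF// !andbT.
by have [vu|] := eqVneq v u => //; rewrite -vu vw in uw.
Qed.

(** If [u] is not inside [v], then [CA u v] has sum 0, and induction on [v] kills all terms but
    [C u v]. For distinct sets one of the two inclusions fails. *)
Lemma subset_sums_orthogonal u v : u != v -> C u v = 0.
Proof.
have sub0 : forall u v, ~~ (u \subset v) -> C u v = 0.
  move=> {}u {}v; have [n] := ubnP #|v|; elim: n v => // n IH v.
  rewrite ltnS => vn uv; have := CA u v.
  rewrite big_subset_proper (subset_sums_cross0 uv) big1 ?addr0// => w wv.
  apply: IH; first exact: leq_trans (proper_card wv) vn.
  by apply: contra uv => uw; exact: fintype.subset_trans uw (proper_sub wv).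
rewrite finset.eqEsubset negb_and => /orP[]; first exact: sub0.
by rewrite Csym; exact: sub0.
Qed.

(** By orthogonality [C v v] is the only nonzero term of [CA v u], so it equals [A v u]. *)
Lemma subset_sums_diag u : \sum_(v : {set T} | v \subset u) C v v = M u.
Proof.
rewrite -[in RHS](finset.setIid u) -AM; apply: eq_bigr => v vu.
rewrite -CA (bigD1 v)//= big1 ?addr0// => w /andP[_ wv].
by apply: subset_sums_orthogonal; rewrite eq_sym.
Qed.

Lemma sum_diag : \sum_(u : {set T} | u != finset.set0) C u u =
  M [set: T]%SET - M finset.set0.
Proof.
rewrite -!subset_sums_diag.
rewrite [X in _ = X - _](bigD1 finset.set0) ?finset.sub0set//=.
rewrite [X in _ - X](big_pred1 finset.set0) => [|u];
  last by rewrite finset.subset0.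
by rewrite [RHS]addrC addrA addNr add0r; apply: eq_bigl => u;
  rewrite finset.subsetT.
Qed.

(** Counting the elements [j] of [u]: the sets containing [j] are all sets except the subsets of the
    complement of [j]. *)
Lemma sum_card_diag : \sum_(u : {set T}) #|u|%:R * C u u =
  \sum_j (M [set: T]%SET - M (~: [set j]%SET)).
Proof.
transitivity (\sum_(u : {set T}) \sum_(j in u) C u u).
  by apply: eq_bigr => u _; rewrite sumr_const mulr_natl.
rewrite (exchange_big_dep xpredT)//=; apply: eq_bigr => j _.
rewrite -!subset_sums_diag [X in _ = X - _](bigID (fun u => j \in u))/=.
rewrite -[LHS]addr0 -addrA; congr (_ + _).
  by apply: eq_bigl => u; rewrite finset.subsetT.
apply/eqP; rewrite eq_sym subr_eq0; apply/eqP; apply: eq_bigl => u.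
by rewrite finset.subsetT finset.subsetC finset.sub1set inE.
Qed.

End subset_sums.

(** * ANOVA variances of a function with values in [0, 1] *)

Section anova_mean_dim.
Local Open Scope ereal_scope.
Context {R : realType} {d : nat}.
Local Notation P := (@std_gaussian R d).
Implicit Types (f g h : d.-tuple R -> R) (u v w : {set 'I_d}).

Lemma anova_mobius f u x : anova P f u x = mobius (cond_exp P f ^~ x) u.
Proof.
rewrite /anova /mobius; move: #|u|.+1 => k; elim: k u => //= n IH v.
congr (_ - _)%R.
by apply: eq_bigr => w _; exact: IH.
Qed.

Lemma measurable_mobius (G : {set 'I_d} -> d.-tuple R -> R) u :
  (forall v, measurable_fun setT (G v)) ->
  measurable_fun setT (fun x => mobius (G ^~ x) u).
Proof.
move=> mG; rewrite /mobius; move: #|u|.+1 => k; elim: k u => [|n IH] v /=.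
  exact: measurable_cst.
apply: measurable_funB => //.
under [X in measurable_fun _ X]eq_fun do rewrite big_mkcond/=.
apply: measurable_sum => w.
by have [wv|wv] := boolP (w \proper v); [exact: IH|exact: measurable_cst].
Qed.

Lemma mobius_bounded n : exists K : R, forall (g : {set 'I_d} -> R) u,
  (forall v, `|g v| <= 1)%R -> (`|mobius_rec n g u| <= K)%R.
Proof.
elim: n => [|n [K IH]]; first by exists 0%R => g u _; rewrite normr0.
(* With [|K|] all terms are nonnegative, so the sum over proper subsets may be enlarged to all
   sets. *)
exists (1 + \sum_(v : {set 'I_d}) `|K|)%R => g u g1 /=.
apply: (le_trans (ler_normB _ _)); apply: lerD => //.
apply: (le_trans (ler_norm_sum _ _ _)).
rewrite big_mkcond/=; apply: ler_sum => v _; case: ifP => _ //.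
by apply: (le_trans (IH _ _ g1)); exact: ler_norm.
Qed.

Definition bounded_mfun g :=
  measurable_fun setT g /\ exists K : R, forall x, (`|g x| <= K)%R.

Definition inner g h : R := fine (\int[P]_x (g x * h x)%:E).

Lemma inner_integrable g h : bounded_mfun g -> bounded_mfun h ->
  P.-integrable setT (fun x => (g x * h x)%:E).
Proof.
move=> [mg [K gK]] [mh [L hL]].
apply: measurable_bounded_integrable => //.
- by rewrite /= probability_setT ltry.
- exact: measurable_funM.
- exists (K * L)%R; split; first exact: num_real.
  move=> M KLM x _ /=; rewrite normrM (le_trans _ (ltW KLM))//.
  exact: ler_pM.
Qed.

Lemma inner_suml (I : finType) (Q : pred I) (g : I -> d.-tuple R -> R) h :
  (forall i, bounded_mfun (g i)) -> bounded_mfun h ->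
  (\sum_(i | Q i) inner (g i) h = inner (fun x => \sum_(i | Q i) g i x) h)%R.
Proof.
move=> bg bh; have ig i := inner_integrable (bg i) bh.
apply: EFin_inj; rewrite -sumEFin.
have -> : (inner (fun x => \sum_(i | Q i) g i x)%R h)%:E =
    \int[P]_x (\sum_(i | Q i) (g i x * h x)%:E).
  rewrite /inner; under eq_integral do rewrite mulr_suml -sumEFin.
  by rewrite fineK// integral_sum// sum_fin_num//;
    apply/allP => z /mapP[i _ ->]; exact: integrable_fin_num.
rewrite integral_sum//; apply: eq_bigr => i _.
by rewrite /inner fineK//; exact: integrable_fin_num.
Qed.

Lemma innerC g h : inner g h = inner h g.
Proof. by rewrite /inner; under eq_integral do rewrite mulrC. Qed.

Variable f : d.-tuple R -> R.
Hypothesis uf : measurable_unit f.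

(** The version of the ANOVA component built from averages: bounded, with the subset sum identity at
    every point. *)
Definition anova_average u (x : d.-tuple R) : R :=
  mobius ((average ^~ f) ^~ x) u.

Lemma bounded_mfun_average u : bounded_mfun (average u f).
Proof.
have [ma a01] := measurable_unit_average u uf; split => //; exists 1%R => x.
by have /andP[? ?] := a01 x; rewrite ger0_norm.
Qed.

Lemma bounded_mfun_anova_average u : bounded_mfun (anova_average u).
Proof.
split; first by apply: measurable_mobius => v; case: (bounded_mfun_average v).
have [K hK] := mobius_bounded #|u|.+1; exists K => x; apply: hK => v.
have [_ a01] := measurable_unit_average v uf.
by have /andP[? ?] := a01 x; rewrite ger0_norm.
Qed.

Lemma inner_average u v :
  inner (average u f) (average v f) = inner f (average (u :&: v) f).
Proof.
rewrite /inner (average_self_adjoint u uf (measurable_unit_average v uf)).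
by congr fine; apply: eq_integral => x _; rewrite average_average.
Qed.

Lemma sum_inner_anova_average u w :
  (\sum_(v : {set 'I_d} | v \subset u) inner (anova_average v) (average w f) =
   inner f (average (u :&: w) f))%R.
Proof.
rewrite (inner_suml _ bounded_mfun_anova_average (bounded_mfun_average w)).
rewrite -inner_average /inner; congr fine.
by apply: eq_integral => x _; rewrite sum_mobius.
Qed.

Lemma sum_inner_anova_average2 u v :
  (\sum_(w : {set 'I_d} | w \subset v)
     inner (anova_average u) (anova_average w) =
   inner (anova_average u) (average v f))%R.
Proof.
under eq_bigr do rewrite innerC.
rewrite (inner_suml _ bounded_mfun_anova_average
  (bounded_mfun_anova_average u)).
rewrite [RHS]innerC /inner; congr fine.
by apply: eq_integral => x _; rewrite sum_mobius.
Qed.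

(** The chosen conditional expectations agree with the averages outside a null set, and the finitely
    many null sets, one for each [v], are merged into one. *)
Lemma sigma2E u : u != finset.set0 ->
  sigma2 P f u = inner (anova_average u) (anova_average u).
Proof.
move=> u0; rewrite /sigma2 (negbTE u0) unlock /inner; congr fine.
have mc v : measurable_fun setT (cond_exp P f v).
  apply/measurable_EFinP; apply: measurable_int.
  rewrite /cond_exp; case: xgetP => [g _ [_ ig _]|]; first exact: ig.
  by move=> /(_ (average v f))[]; exact: is_cond_exp_average.
have ma : measurable_fun setT (anova P f u).
  rewrite (_ : anova P f u = fun x => mobius (cond_exp P f ^~ x) u).
    exact: measurable_mobius.
  by apply/funext => x; exact: anova_mobius.
have [mb _] := bounded_mfun_anova_average u.
apply: ae_eq_integral => //.
- by apply/measurable_EFinP; exact: measurable_funX.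
- by apply/measurable_EFinP; exact: measurable_funM.
have cE : {ae P, forall x v, setT x ->
    (cond_exp P f v x)%:E = (average v f x)%:E}.
  by apply: filter_forall => v; exact: cond_exp_average.
apply: filterS cE => x cE _ /=.
rewrite expr2 anova_mobius /anova_average.
suff -> : cond_exp P f ^~ x = (average ^~ f) ^~ x by [].
by apply/funext => v; have [] := cE v I.
Qed.

Lemma sum_sigma2 : (\sum_(u : {set 'I_d}) sigma2 P f u =
  inner f (average [set: 'I_d]%SET f) - inner f (average finset.set0 f))%R.
Proof.
have <- := @sum_diag R _ _ _ (fun s => inner f (average s f))
  sum_inner_anova_average sum_inner_anova_average2 (fun u v => innerC _ _).
rewrite (bigD1 finset.set0)//= {1}/sigma2 eqxx add0r.
by apply: eq_bigr => u u0; exact: sigma2E.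
Qed.

Lemma sum_card_sigma2 : (\sum_(u : {set 'I_d}) #|u|%:R * sigma2 P f u =
  \sum_(j < d) (inner f (average [set: 'I_d]%SET f) -
                inner f (average (~: [set j]%SET) f)))%R.
Proof.
have <- := @sum_card_diag R _ _ _ (fun s => inner f (average s f))
  sum_inner_anova_average sum_inner_anova_average2 (fun u v => innerC _ _).
apply: eq_bigr => u _; have [->|u0] := eqVneq u finset.set0.
  by rewrite cards0 !mul0r.
by rewrite sigma2E.
Qed.

(** The difference is the sum of the squared norms of the components indexed by the nonempty subsets
    of [u]. *)
Lemma inner_average_ge u :
  (inner f (average finset.set0 f) <= inner f (average u f))%R.
Proof.
have D := @subset_sums_diag R _ _ _ (fun s => inner f (average s f))
  sum_inner_anova_average sum_inner_anova_average2 (fun u v => innerC _ _).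
rewrite -!D (big_pred1 finset.set0) => [|v]; last by rewrite finset.subset0.
rewrite (bigD1 finset.set0) ?finset.sub0set//=.
rewrite lerDl; apply: sumr_ge0 => v _; rewrite fine_ge0//.
by apply: integral_ge0 => x _; rewrite lee_fin -expr2 sqr_ge0.
Qed.

End anova_mean_dim.

(** * Total effects of the ridge step function *)

Section ridge_step_moments.
Local Open Scope ereal_scope.
Context {R : realType} {d : nat} (theta : 'rV[R]_d) (t : R).
Hypothesis theta1 : norm2 theta = 1%R.
Local Notation P := (@std_gaussian R d).
Local Notation N01 := (normal_prob (0 : R) 1).
Local Notation f := (ridge_step theta t).
Implicit Types (x z : d.-tuple R) (j : 'I_d).

Lemma sum_sqr_theta : (\sum_(i < d) theta 0 i ^+ 2 = 1)%R.
Proof.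
have s0 : (0 <= \sum_(i < d) theta 0 i ^+ 2)%R.
  by apply: sumr_ge0 => i _; exact: sqr_ge0.
by rewrite -(sqr_sqrtr s0) -/(norm2 theta) theta1 expr1n.
Qed.

Lemma measurable_linear (c : 'I_d -> R) :
  measurable_fun setT (fun x => \sum_(i < d) c i * tnth x i)%R.
Proof.
apply: measurable_sum => i; apply: measurable_funM => //.
exact: measurable_tnth.
Qed.

Lemma measurable_itvoy : measurable [set y : R | (t < y)%R].
Proof. by have := measurable_itv `]t, +oo[; rewrite set_itvoy. Qed.

Lemma measurable_unit_ridge_step : measurable_unit f.
Proof.
split.
  exact: (measurableT_comp (measurable_indic measurable_itvoy)
    (measurable_linear _)).
by move=> x; rewrite /ridge_step indicE; case: (_ \in _); rewrite ?lexx ?ler01.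
Qed.

Lemma integral_ridge_step : \int[P]_x (f x)%:E = (Phi (- t))%:E.
Proof.
have m1 := measurable_indic measurable_itvoy : measurable_fun setT (_ : R -> R).
rewrite (@ge0_integral_std_gaussian_linear R d (theta 0%R)
  (fun y => (\1_[set y : R | (t < y)%R] y)%:E)).
- under eq_integral do rewrite sum_sqr_theta sqrtr1 mul1r.
  rewrite integral_indic ?setIT;
    [exact: normal_prob_gt|by []|exact: measurable_itvoy].
- exact/measurable_EFinP.
- by move=> y; rewrite lee_fin.
Qed.

Lemma ridge_step_idem x : (f x * f x = f x)%R.
Proof.
by rewrite /ridge_step indicE; case: (_ \in _); rewrite ?mulr1 ?mulr0.
Qed.

Lemma average_setT x : average [set: 'I_d]%SET f x = f x.
Proof.
rewrite /average (_ : (fun z => _) = cst (f x)%:E); last first.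
  apply/funext => z; congr (f _)%:E.
  by apply: eq_from_tnth => i; rewrite tnth_mix /= inE.
by rewrite integral_cst//= probability_setT mule1.
Qed.

Lemma inner_average_setT : inner f (average [set: 'I_d]%SET f) = Phi (- t).
Proof.
rewrite /inner; under eq_integral do rewrite average_setT ridge_step_idem.
by rewrite integral_ridge_step.
Qed.

Lemma average_set0 x : average finset.set0 f x = Phi (- t).
Proof.
rewrite /average; under eq_integral => z _.
  rewrite (_ : mix _ x z = z); last first.
    by apply: eq_from_tnth => i; rewrite tnth_mix /= inE.
  over.
by rewrite integral_ridge_step.
Qed.

Lemma inner_average_set0 : inner f (average finset.set0 f) = (Phi (- t) ^+ 2)%R.
Proof.
have [mf f01] := measurable_unit_ridge_step.
rewrite /inner; under eq_integral do rewrite average_set0 EFinM.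
rewrite ge0_integralZr//.
- by rewrite integral_ridge_step -EFinM.
- exact/measurable_EFinP.
- by move=> x _; rewrite lee_fin; case/andP: (f01 x).
- by rewrite lee_fin fine_ge0.
Qed.

(** [c * tnth x j] is a linear form with a single coefficient, hence distributed like [|c|] times a
    standard normal variable. *)
Lemma integral_coord_pos_part (c : R) j :
  \int[P]_x (Num.max (c * tnth x j) 0)%:E = (`|c| * normal_peak 1)%:E.
Proof.
have mmax : measurable_fun setT (fun x : R => (Num.max x 0)%:E).
  by apply/measurable_EFinP; exact: measurable_maxr.
transitivity (\int[P]_x
    (Num.max (\sum_(i < d) (if i == j then c else 0) * tnth x i)%R 0%R)%:E).
  apply: eq_integral => x _; congr (Num.max _ _)%:E.
  rewrite (bigD1 j)//= eqxx big1 ?addr0// => i /negbTE ->.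
  by rewrite mul0r.
rewrite (@ge0_integral_std_gaussian_linear R d
  (fun i => if i == j then c else 0%R)
  (fun y => (Num.max y 0)%:E))//; last first.
  by move=> x; rewrite lee_fin le_max lexx orbT.
rewrite (bigD1 j)//= eqxx big1 ?addr0 => [|i /negbTE ->];
  last by rewrite expr0n.
rewrite sqrtr_sqr EFinM -integral_normal_pos_part -ge0_integralZl//.
- by apply: eq_integral => x _; rewrite -EFinM maxr_pMr// mulr0.
- by move=> x _; rewrite lee_fin le_max lexx orbT.
Qed.

End ridge_step_moments.

(** * The effect of resampling one coordinate *)

Section ridge_step_coordinate.
Local Open Scope ereal_scope.
Context {R : realType} {d : nat} (theta : 'rV[R]_d) (t : R).
Hypothesis theta1 : norm2 theta = 1%R.
Local Notation P := (@std_gaussian R d).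
Local Notation N01 := (normal_prob (0 : R) 1).
Local Notation f := (ridge_step theta t).
Implicit Types (x z : d.-tuple R) (j : 'I_d).

Lemma measurable_unitM (g h : d.-tuple R -> R) :
  measurable_unit g -> measurable_unit h ->
  measurable_unit (fun x => g x * h x)%R.
Proof.
move=> [mg g01] [mh h01]; split; first exact: measurable_funM.
move=> x; have /andP[? ?] := g01 x; have /andP[? ?] := h01 x.
by rewrite mulr_ge0//= mulr_ile1.
Qed.

(** As [f] is an indicator, [inner f f] is the integral of [f]; splitting [f] into [f * (1 - f')]
    and [f * f'], with [f'] its value after resampling, isolates the difference. *)
Lemma total_effectE j :
  (inner f (average [set: 'I_d]%SET f) -
   inner f (average (~: [set j]%SET) f))%:E =
  \int[P]_x \int[P]_z (f x * (1 - f (mix (mem (~: [set j]%SET)) x z)))%:E.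
Proof.
have uf := measurable_unit_ridge_step theta t; have [mf f01] := uf.
set u := ~: [set j]%SET; pose m x z := mix (mem u) x z.
have mfm : measurable_fun setT
    (fun p : d.-tuple R * d.-tuple R => f (m p.1 p.2)).
  by apply/measurable_EFinP; exact: measurable_unit_mix.
have mf1 : measurable_fun setT (fun p : d.-tuple R * d.-tuple R => f p.1).
  by apply: measurableT_comp mf _.
have mG : measurable_fun setT (fun p : d.-tuple R * d.-tuple R =>
    (f p.1 * (1 - f (m p.1 p.2)))%:E).
  apply/measurable_EFinP; apply: measurable_funM => //.
  exact: measurable_funB.
have mH : measurable_fun setT (fun p : d.-tuple R * d.-tuple R =>
    (f p.1 * f (m p.1 p.2))%:E).
  by apply/measurable_EFinP; apply: measurable_funM.
have f0 x : (0 <= f x)%R by case/andP: (f01 x).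
have f1 x : (f x <= 1)%R by case/andP: (f01 x).
have G0 x z : 0 <= (f x * (1 - f (m x z)))%:E.
  by rewrite lee_fin mulr_ge0// subr_ge0.
have H0 x z : 0 <= (f x * f (m x z))%:E by rewrite lee_fin mulr_ge0.
have mG1 x : measurable_fun setT (fun z => (f x * (1 - f (m x z)))%:E).
  exact: (measurableT_comp mG (measurable_pair1 x)).
have mH1 x : measurable_fun setT (fun z => (f x * f (m x z))%:E).
  exact: (measurableT_comp mH (measurable_pair1 x)).
have IE : (inner f (average u f))%:E = \int[P]_x \int[P]_z (f x * f (m x z))%:E.
  rewrite /inner fineK.
    apply: eq_integral => x _; rewrite EFinM averageE// -ge0_integralZl//.
    - apply/measurable_EFinP.
      exact: (measurableT_comp mfm (measurable_pair1 x)).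
    - by move=> z _; rewrite lee_fin.
    - by rewrite lee_fin.
  have ua := measurable_unit_average u uf.
  apply: integrable_fin_num => //.
  exact: (integrable_measurable_unit (measurable_unitM uf ua)).
rewrite (inner_average_setT t theta1) EFinB -(integral_ridge_step t theta1) IE.
have -> : \int[P]_x (f x)%:E = \int[P]_x \int[P]_z (f x * (1 - f (m x z)))%:E +
    \int[P]_x \int[P]_z (f x * f (m x z))%:E.
  rewrite -ge0_integralD//; last 4 first.
  - by move=> x _; exact: integral_ge0.
  - exact: measurable_fun_ge0_integral.
  - by move=> x _; exact: integral_ge0.
  - exact: measurable_fun_ge0_integral.
  apply: eq_integral => x _; rewrite -ge0_integralD//.
  rewrite [RHS](eq_integral (cst (f x)%:E)).
    by rewrite integral_cst//= probability_setT mule1.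
  by move=> z _; rewrite -EFinD -mulrDr subrK mulr1.
by rewrite addeK// -IE.
Qed.

End ridge_step_coordinate.

Section ridge_step_total_effect.
Local Open Scope ereal_scope.
Context {R : realType} {d : nat} (theta : 'rV[R]_d) (t : R).
Hypothesis theta1 : norm2 theta = 1%R.
Local Notation P := (@std_gaussian R d).
Local Notation N01 := (normal_prob (0 : R) 1).
Local Notation f := (ridge_step theta t).

(** One factor [normal_peak 1], over the square root, bounds the density of the remaining linear
    form. The other one and [2 * |theta_j|] come from the expected positive parts of [theta_j x_j]
    and [- theta_j z_j], which bound the expected interval length. *)
Lemma total_effect_le (j : 'I_d) : (0 < 1 - theta 0 j ^+ 2)%R ->
  (inner f (average [set: 'I_d]%SET f) - inner f (average (~: [set j]%SET) f) <=
   2 * `|theta 0 j| * normal_peak 1 ^+ 2 / Num.sqrt (1 - theta 0 j ^+ 2))%R.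
Proof.
set c := theta 0%R j; set s := Num.sqrt _; set p := normal_peak (1 : R).
move=> c1; have s0 : (0 < s)%R by rewrite sqrtr_gt0.
have p0 : (0 <= p)%R := normal_peak_ge0 1.
pose b i : R := if i == j then 0%R else theta 0%R i.
pose w (x : d.-tuple R) := (\sum_(i < d) b i * tnth x i)%R.
have wE (x : d.-tuple R) :
    (\sum_(i < d) theta 0 i * tnth x i = w x + c * tnth x j)%R.
  rewrite (bigD1 j)//= /w [in RHS](bigD1 j)//= /b eqxx mul0r add0r addrC.
  by congr (_ + _)%R; apply: eq_bigr => i /negbTE ->.
have bE : Num.sqrt (\sum_(i < d) b i ^+ 2)%R = s.
  congr Num.sqrt; rewrite -(sum_sqr_theta theta1) (bigD1 j)//= /b eqxx.
  rewrite expr0n add0r.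
  rewrite [in RHS](bigD1 j)//= -/c addrAC subrr add0r.
  by apply: eq_bigr => i /negbTE ->.
(* The indicator of [t - h < y <= t - k], as a product of indicators of fixed half-lines so that
   joint measurability follows by composition. *)
pose in1 (h k y : R) : \bar R := (\1_[set r : R | 0 < r] (y + h - t) *
  \1_[set r : R | 0 <= r] (t - k - y))%R%:E.
have in1E (h k y : R) :
    in1 h k y = (\1_[set y : R | t - h < y <= t - k]%R y)%:E.
  rewrite /in1 !indicE -natrM mulnb; congr ((nat_of_bool _)%:R%:E).
  apply/idP/idP; rewrite !inE/=.
    by move=> /andP[]; rewrite !inE/= subr_gt0 ltrBlDr subr_ge0 => -> ->.
  rewrite ltrBlDr => /andP[? ?]; apply/andP.
  by rewrite !inE/= subr_gt0 subr_ge0.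
have in1_ge0 (h k y : R) : 0 <= in1 h k y by rewrite in1E lee_fin.
have min1 d' (X : measurableType d') (h k y : X -> R) : measurable_fun setT h ->
    measurable_fun setT k -> measurable_fun setT y ->
    measurable_fun setT (fun x => in1 (h x) (k x) (y x)).
  move=> mh mk my; apply/measurable_EFinP; apply: measurable_funM.
    apply: measurableT_comp.
      apply: measurable_indic.
      by have := measurable_itv `]0%R : R, +oo[; rewrite set_itvoy.
    by apply: measurable_funB => //; exact: measurable_funD.
  apply: measurableT_comp.
    apply: measurable_indic.
    by have := measurable_itv `[0%R : R, +oo[; rewrite set_itvcy.
  by apply: measurable_funB => //; exact: measurable_funB.
have mw : measurable_fun setT w := measurable_linear b.
have mj : measurable_fun setT (fun x => c * tnth x j)%R.
  by apply: measurable_funM => //; exact: measurable_tnth.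
(* [x] and [z] enter only through their j-th coordinates, [y] only through the others. *)
pose K (x y z : d.-tuple R) := in1 (c * tnth x j)%R (c * tnth z j)%R (w y).
have mK d' (X : measurableType d') (x y z : X -> d.-tuple R) :
    measurable_fun setT x -> measurable_fun setT y -> measurable_fun setT z ->
    measurable_fun setT (fun r => K (x r) (y r) (z r)).
  by move=> mx my mz; apply: min1; [exact: measurableT_comp mj mx|
    exact: measurableT_comp mj mz|exact: measurableT_comp mw my].
rewrite -lee_fin (total_effectE t theta1).
have -> : \int[P]_x \int[P]_z
      (f x * (1 - f (mix (mem (~: [set j]%SET)) x z)))%:E =
    \int[P]_x \int[P]_z K x x z.
  apply: eq_integral => x _; apply: eq_integral => z _; rewrite /K in1E.
  rewrite /ridge_step !indicE; congr EFin.
  have -> : (mix (mem (~: [set j]%SET)) x z \in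
      [set x | (t < \sum_(i < d) theta 0 i * tnth x i)%R]) =
      (t < w x + c * tnth z j)%R.
    have -> : (w x = w (mix (mem (~: [set j]%SET)) x z))%R.
      apply: eq_bigr => i _; rewrite /b tnth_mix /= !inE.
      by case: eqP => //; rewrite !mul0r.
    have -> : tnth z j = tnth (mix (mem (~: [set j]%SET)) x z) j.
      by rewrite tnth_mix /= !inE eqxx.
    by apply/idP/idP; rewrite inE /= wE.
  have -> : (x \in [set x | (t < \sum_(i < d) theta 0 i * tnth x i)%R]) =
      (t < w x + c * tnth x j)%R.
    by apply/idP/idP; rewrite inE /= wE.
  have -> : (w x \in [set y : R | t - c * tnth x j < y <= t - c * tnth z j]%R) =
      (t < w x + c * tnth x j)%R && ~~ (t < w x + c * tnth z j)%R.
    by apply/idP/idP; rewrite inE /= ltrBlDr lerBrDr -leNgt.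
  by case: (t < _)%R; case: (t < _)%R;
    rewrite /= ?(subr0, subrr, mul0r, mulr0, mulr1).
(* Independence of the j-th coordinate of x and w x. *)
have -> : \int[P]_x \int[P]_z K x x z = \int[P]_x \int[P]_y \int[P]_z K x y z.
  transitivity (\int[P]_x \int[P]_y \int[P]_z K x x z).
    apply: eq_integral => x _.
    by rewrite integral_cst//= probability_setT mule1.
  (* Here [mix] keeps the j-th coordinate of [x] and takes all others from [y], so that [w] of it is
     [w y]. *)
  rewrite -[LHS](@ge0_integral_mix R d (mem [set j]%SET)
    (fun x _ => \int[P]_z K x x z)).
  - apply: eq_integral => x _; apply: eq_integral => y _.
    apply: eq_integral => z _.
    rewrite /K tnth_mix /= !inE eqxx; congr in1.
    apply: eq_bigr => i _; rewrite /b tnth_mix /= !inE.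
    by case: eqP => //; rewrite !mul0r.
  - apply: (@measurable_fun_ge0_integral _ _ _ _ _ _
      (fun (q : d.-tuple R * d.-tuple R) z => K q.1 q.1 z));
      last by move=> *; exact: in1_ge0.
    apply: mK => //; exact: (measurableT_comp measurable_fst measurable_fst).
  - by move=> x _; apply: integral_ge0 => z _; exact: in1_ge0.
have -> : \int[P]_x \int[P]_y \int[P]_z K x y z =
    \int[P]_x \int[P]_z \int[P]_y K x y z.
  apply: eq_integral => x _; rewrite [LHS]ge0_integral_exchange; first by [].
    exact: mK.
  by move=> y z; exact: in1_ge0.
have KE x z : \int[P]_y K x y z =
    N01 [set r : R | t - c * tnth x j < s * r <= t - c * tnth z j]%R.
  rewrite /K /w.
  rewrite (@ge0_integral_std_gaussian_linear R d b
    (in1 (c * tnth x j)%R (c * tnth z j)%R)); last 2 first.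
  - exact: min1.
  - by move=> r; exact: in1_ge0.
  rewrite bE; under eq_integral do rewrite in1E.
  transitivity (\int[N01]_r
      (\1_[set r : R | t - c * tnth x j < s * r <= t - c * tnth z j]%R r)%:E).
    by apply: eq_integral => r _; rewrite !indicE.
  rewrite integral_indic ?setIT//.
  rewrite (_ : [set _ | _] = [set` `]((t - c * tnth x j) / s)%R,
      ((t - c * tnth z j) / s)%R]])//.
  by apply/seteqP; split => r /=;
    rewrite in_itv/= ltr_pdivrMr// ler_pdivlMr// ![(r * s)%R]mulrC.
pose A (e : R) (x : d.-tuple R) : R := Num.max (e * tnth x j)%R 0%R.
have mA e : measurable_fun setT (A e).
  apply: measurable_maxr => //; apply: measurable_funM => //.
  exact: measurable_tnth.
have A0 e x : (0 <= A e x)%R by rewrite le_max lexx orbT.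
have IA e : \int[P]_x (A e x)%:E = (`|e| * p)%:E := integral_coord_pos_part e j.
have ps0 : (0 <= p / s)%R by rewrite divr_ge0// ltW.
have mKz : measurable_fun setT
    (fun q : d.-tuple R * d.-tuple R => \int[P]_y K q.1 y q.2).
  apply: (@measurable_fun_ge0_integral _ _ _ _ _ _
    (fun (q : d.-tuple R * d.-tuple R) y => K q.1 y q.2)).
    apply: mK => //.
      exact: (measurableT_comp measurable_fst measurable_fst).
    exact: (measurableT_comp measurable_snd measurable_fst).
  by move=> *; exact: in1_ge0.
have K0 x z : 0 <= \int[P]_y K x y z.
  by apply: integral_ge0 => y _; exact: in1_ge0.
(* The positive part of [c x_j - c z_j] is at most the sum of the positive parts of [c x_j] and
   [- c z_j]. *)
have step x z : \int[P]_y K x y z <=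
    (p / s)%:E * ((A c x)%:E + (A (- c)%R z)%:E).
  rewrite KE; apply: (le_trans (normal_prob_interval_le _ _ s0)).
  rewrite -EFinD -EFinM lee_fin ler_wpM2l// ge_max addr_ge0// andbT.
  rewrite (_ : _ - _ = c * tnth x j + - c * tnth z j)%R; last by ring.
  by apply: lerD; rewrite le_max lexx.
have mAE e : measurable_fun setT (EFin \o A e) by exact/measurable_EFinP.
have AE0 e x : 0 <= (A e x)%:E by rewrite lee_fin.
have stepx x : \int[P]_z \int[P]_y K x y z <=
    (p / s)%:E * ((A c x)%:E + (`|c| * p)%:E).
  apply: (@le_trans _ _
    (\int[P]_z ((p / s)%:E * ((A c x)%:E + (A (- c)%R z)%:E)))).
    apply: ge0_le_integral => //.
    - exact: (measurableT_comp mKz (measurable_pair1 x)).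
    - by apply: measurable_funeM; apply: emeasurable_funD => //; exact: mAE.
  rewrite ge0_integralZl//; last 2 first.
  - by apply: emeasurable_funD => //; exact: mAE.
  - by move=> z _; exact: adde_ge0.
  rewrite ge0_integralD//; last exact: mAE.
  by rewrite integral_cst//= probability_setT mule1 IA normrN.
apply: (@le_trans _ _ (\int[P]_x ((p / s)%:E * ((A c x)%:E + (`|c| * p)%:E)))).
  apply: ge0_le_integral => //.
  - by move=> x _; exact: integral_ge0.
  - exact: (@measurable_fun_ge0_integral _ _ _ _ _ _
      (fun x z => \int[P]_y K x y z)).
  - by apply: measurable_funeM; apply: emeasurable_funD => //; exact: mAE.
rewrite ge0_integralZl//; last 2 first.
- by apply: emeasurable_funD => //; exact: mAE.
- by move=> x _; rewrite adde_ge0// lee_fin mulr_ge0.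
rewrite ge0_integralD//; [|exact: mAE|by move=> *; rewrite lee_fin mulr_ge0].
rewrite integral_cst//= probability_setT mule1 IA -EFinD -EFinM lee_fin.
by rewrite le_eqVlt; apply/orP; left; apply/eqP; ring.
Qed.

End ridge_step_total_effect.

Lemma total_effect_le_sqrt_pi (R : realType) (d : nat) (theta : 'rV[R]_d)
    (t : R) (j : 'I_d) : norm2 theta = 1 ->
  inner (ridge_step theta t) (average [set: 'I_d]%SET (ridge_step theta t)) -
  inner (ridge_step theta t) (average (~: [set j]%SET) (ridge_step theta t)) <=
  `|theta 0 j| / Num.sqrt pi.
Proof.
move=> theta1; have pi0 := pi_gt0 R.
have sp0 : 0 < Num.sqrt (pi : R) by rewrite sqrtr_gt0.
(* At the threshold, [|theta_j| / (pi sqrt (1 - theta_j^2))] equals [|theta_j| / sqrt pi]. *)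
have [c1|c1] := leP (pi^-1) (1 - theta 0 j ^+ 2).
  have c0 : 0 < 1 - theta 0 j ^+ 2 by apply: lt_le_trans c1; rewrite invr_gt0.
  apply: (le_trans (total_effect_le _ theta1 c0)).
  have -> : normal_peak (1 : R) ^+ 2 = (2 * pi)^-1.
    have p2 : 0 <= (pi : R) *+ 2 by apply: mulrn_wge0; exact: pi_ge0.
    by rewrite /normal_peak expr1n mul1r exprVn (sqr_sqrtr p2) mulr_natl.
  have s1 : (Num.sqrt pi)^-1 <= Num.sqrt (1 - theta 0 j ^+ 2).
    by rewrite -sqrtrV ?ler_wsqrtr// ltW.
  have s0 : 0 < Num.sqrt (1 - theta 0 j ^+ 2) by rewrite sqrtr_gt0.
  have piE : pi = Num.sqrt pi ^+ 2 :> R by rewrite sqr_sqrtr// pi_ge0.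
  rewrite [X in _ / (_ * X)]piE.
  set r := Num.sqrt pi in sp0 s1 *; set s := Num.sqrt (1 - _) in s0 s1 *.
  rewrite (_ : _ / s = `|theta 0 j| / r * (r * s)^-1); last first.
    by field; rewrite !gt_eqF.
  apply: ler_piMr; first by rewrite divr_ge0// ltW.
  rewrite invf_le1 ?mulr_gt0//.
  by rewrite -(divff (lt0r_neq0 sp0)) ler_wpM2l// ltW.
have uf := measurable_unit_ridge_step theta t.
(* The total effect is at most the full variance, hence at most 1/4; this suffices since
   [|theta_j| >= 1/2] and [sqrt pi <= 2]. *)
apply: (@le_trans _ _ (Phi (- t) - Phi (- t) ^+ 2)).
  rewrite -(inner_average_set0 t theta1) -(inner_average_setT t theta1).
  by rewrite lerD2l lerN2; exact: inner_average_ge.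
apply: (@le_trans _ _ (4^-1)).
  by have := sqr_ge0 (Phi (- t) - 2^-1); lra.
rewrite ler_pdivlMr//.
have pi4 : (pi : R) < 4 by have := @pihalf_lt2 R; lra.
have pi2 := pi_ge2 R.
have t2 : 2^-1 < theta 0 j ^+ 2.
  have : pi^-1 <= 2^-1 :> R by rewrite lef_pV2 ?posrE.
  by move: c1; lra.
have sp2 : Num.sqrt (pi : R) <= 2.
  by rewrite -(ler_pXn2r (n := 2))// ?nnegrE// sqr_sqrtr; lra.
have a2 : 2^-1 <= `|theta 0 j|.
  rewrite -(ler_pXn2r (n := 2))// ?nnegrE// real_normK ?num_real//.
  by lra.
lra.
Qed.

(** * The bound *)

Section norm1.
Context {R : realType} {d : nat} (theta : 'rV[R]_d).
Hypothesis theta1 : norm2 theta = 1.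

(** Each entry is at most 1 in absolute value, so its square is at most its absolute value. *)
Lemma norm1_ge1 : 1 <= norm1 theta.
Proof.
rewrite -[leLHS](sum_sqr_theta theta1); apply: ler_sum => j _.
have : theta 0 j ^+ 2 <= 1.
  rewrite -(sum_sqr_theta theta1) (bigD1 j)//= lerDl.
  by apply: sumr_ge0 => i _; exact: sqr_ge0.
rewrite -[X in X <= 1]real_normK ?num_real// expr_le1// => j1.
by rewrite -real_normK ?num_real// expr2 ler_piMr.
Qed.

Lemma norm1_le_sqrt : norm1 theta <= Num.sqrt d%:R.
Proof.
have d0 : (0 < d)%N.
  case: d theta theta1 => // theta0 H; have := @oner_neq0 R.
  by rewrite -H /norm2 big_ord0 sqrtr0 eqxx.
have sd0 : 0 < Num.sqrt (d%:R : R) by rewrite sqrtr_gt0 ltr0n.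
set q := Num.sqrt d%:R in sd0 *.
have q2 : q ^+ 2 = d%:R by rewrite sqr_sqrtr.
(* AM-GM: [2 a <= q a^2 + 1 / q] *)
apply: (@le_trans _ _ (\sum_(j < d) (q * theta 0 j ^+ 2 + q^-1) / 2)).
  apply: ler_sum => j _; rewrite -real_normK ?num_real//.
  set a := `|_|; rewrite -subr_ge0.
  have -> : (q * a ^+ 2 + q^-1) / 2 - a = (q * a - 1) ^+ 2 / (2 * q).
    by field; rewrite gt_eqF.
  by rewrite divr_ge0 ?sqr_ge0// mulr_ge0// ltW.
rewrite -mulr_suml big_split/= -mulr_sumr (sum_sqr_theta theta1) mulr1.
rewrite sumr_const card_ord -[q^-1 *+ d]mulr_natl -q2 expr2.
by rewrite mulfK ?gt_eqF//; lra.
Qed.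

End norm1.

Theorem theorem4p1 (R : realType) (t : R) (t_ge0 : 0 <= t) :
  (forall (d : nat) (theta : 'rV[R]_d), (2 <= d)%N -> norm2 theta = 1 ->
     mean_dim (std_gaussian d) (ridge_step theta t) <= mean_dim_bound theta t)
  /\
  (exists C : R, \forall d \near \oo,
     forall theta : 'rV[R]_d, norm2 theta = 1 ->
       `|mean_dim_bound theta t| <= C * `|Num.sqrt (d%:R * ln d%:R)|).
Proof.
have Phi_ge0 (s : R) : 0 <= Phi s by exact: fine_ge0.
split.
  move=> d theta _ theta1; have uf := measurable_unit_ridge_step theta t.
  rewrite /mean_dim (sum_card_sigma2 uf) (sum_sigma2 uf).
  rewrite (inner_average_setT t theta1) (inner_average_set0 t theta1).
  have -> : Phi (- t) - Phi (- t) ^+ 2 = Phi t * Phi (- t).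
    by rewrite PhiN; ring.
  set V := Phi t * Phi (- t); have V0 : 0 <= V by rewrite mulr_ge0.
  (* The [Phi (- t)] left in the numerator becomes an inner product again, to match the bound on
     total effects. *)
  rewrite -(inner_average_setT t theta1) /mean_dim_bound -/V.
  move: V V0 => V V0; apply: (@le_trans _ _ (norm1 theta / Num.sqrt pi / V)).
    rewrite ler_wpM2r ?invr_ge0// /norm1 mulr_suml; apply: ler_sum => j _.
    exact: total_effect_le_sqrt_pi.
  rewrite mulrDr sqrtrM// invfM.
  (* As [sqrt 2 / sqrt (2 pi) = 1 / sqrt pi], this is the first summand of the bound; the second is
     nonnegative. *)
  have -> : norm1 theta / Num.sqrt pi / V =
      norm1 theta * (V^-1 * (Num.sqrt 2 * Num.sqrt pi)^-1) * Num.sqrt 2.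
    by move: (V^-1) => v; field; rewrite !gt_eqF ?sqrtr_gt0 ?pi_gt0.
  rewrite lerDl !mulr_ge0// ?invr_ge0 ?mulr_ge0//.
  by apply: sumr_ge0.
pose D : R := Phi t * Phi (- t) * Num.sqrt (2 * pi).
have D0 : 0 <= D by rewrite !mulr_ge0.
have ln2 : 0 < ln (2 : R) by rewrite ln_gt0// ltr1n.
(* For [d >= 2], [sqrt 2] is at most [sqrt 2 / sqrt (ln 2)] times [sqrt (ln d)]; the logarithm in
   the bound is at most [ln d] because [norm1 theta >= 1]. *)
exists (D^-1 * (Num.sqrt 2 / Num.sqrt (ln 2) + 2)); exists 2%N => //.
move=> d /= d2 theta theta1.
have n1 := norm1_ge1 theta1; have nd := norm1_le_sqrt theta1.
have d0 : 0 < (d%:R : R) by rewrite ltr0n (leq_trans _ d2).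
have lnd : ln 2 <= ln (d%:R : R) by rewrite ler_ln ?posrE// ler_nat.
have sd0 : 0 <= Num.sqrt (d%:R : R) by exact: sqrtr_ge0.
have sl0 : 0 < Num.sqrt (ln 2 : R) by rewrite sqrtr_gt0.
have lnd2 : Num.sqrt (ln 2 : R) <= Num.sqrt (ln d%:R) by exact: ler_wsqrtr.
have lnn : Num.sqrt (ln ((norm1 theta)^-1 * d%:R)) <= Num.sqrt (ln (d%:R : R)).
  have n0 : 0 < norm1 theta by exact: lt_le_trans n1.
  rewrite ler_wsqrtr// ler_ln ?posrE ?mulr_gt0 ?invr_gt0//.
  by apply: ler_piMl; [exact: ltW|rewrite invf_le1].
rewrite (sqrtrM _ (ltW d0)) [X in _ <= _ * X]ger0_norm ?mulr_ge0//.
rewrite ger0_norm; last first.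
  by rewrite /mean_dim_bound -/D !mulr_ge0 ?addr_ge0 ?invr_ge0//
    (le_trans _ n1).
rewrite /mean_dim_bound -/D.
apply: (@le_trans _ _ (Num.sqrt d%:R / D *
  ((Num.sqrt 2 / Num.sqrt (ln 2) + 2) * Num.sqrt (ln d%:R)))); last first.
  by rewrite le_eqVlt; apply/orP; left; apply/eqP; move: D^-1 => v; ring.
apply: ler_pM; rewrite ?mulr_ge0 ?addr_ge0 ?invr_ge0 ?(le_trans _ n1)//.
  by rewrite ler_wpM2r// invr_ge0.
rewrite [leRHS]mulrDl; apply: lerD; last exact: ler_wpM2l.
by rewrite mulrAC -mulrA ler_peMr// ler_pdivlMr// mul1r.
Qed.
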